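(* Let $n\ge 1$ and let $A$ and $B$ be parabolic subgroups of the braid group $B_n$. Then the double coset problem for the pair $(A,B)$ in $B_n$ is solvable: there is an algorithm which, given an ordered pair $(g,h)\in B_n^2$ (each element given as a word in the standard generators $\sigma_1,\dotsc,\sigma_{n-1}$ and their inverses), decides whether $h\in AgB$, that is, whether there are elements $a\in A$ and $b\in B$ such that $h=agb$.
   Context: $B_n$ is the braid group on $n$ strands, with standard (Artin) generators $\sigma_1,\dotsc,\sigma_{n-1}$ and relations $\sigma_i\sigma_j=\sigma_j\sigma_i$ for $|i-j|\ge 2$ and $\sigma_i\sigma_{i+1}\sigma_i=\sigma_{i+1}\sigma_i\sigma_{i+1}$. A subgroup of $B_n$ is standard parabolic if it is generated by a subset of $\{\sigma_1,\dotsc,\sigma_{n-1}\}$; it is parabolic if it is conjugate in $B_n$ to a standard parabolic subgroup. Each parabolic subgroup is assumed to be given by a standard parabolic subgroup (a subset of the standard generators) together with a conjugating braid (as a word). *)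

(* Defs.v *)
From HB Require Import structures.
From mathcomp Require Import all_boot.
From mathcomp Require Import boolp classical_sets.

Set Implicit Arguments.
Unset Strict Implicit.
Unset Printing Implicit Defensive.

Local Open Scope quotient_scope.
Local Open Scope classical_set_scope.
Local Open Scope group_scope.

(* The generators sigma_1, ..., sigma_(n-1) are indexed from 0 by 'I_n.-1.    *)
(* The letter (i, true) stands for sigma_(i+1), (i, false) for its inverse.   *)
Definition letter (n : nat) : Type := ('I_n.-1 * bool)%type.
HB.instance Definition _ n := Countable.on (letter n).

Definition word (n : nat) : Type := seq (letter n).
HB.instance Definition _ n := Countable.on (word n).

Definition inv_letter n (l : letter n) : letter n := (l.1, ~~ l.2).
Definition inv_word n (w : word n) : word n := rev (map (@inv_letter n) w).

Inductive braid_eq (n : nat) : word n -> word n -> Prop :=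
| braid_eq_refl u : braid_eq u u
| braid_eq_sym u v : braid_eq u v -> braid_eq v u
| braid_eq_trans u v w : braid_eq u v -> braid_eq v w -> braid_eq u w
| braid_eq_cat u u' v v' :
    braid_eq u u' -> braid_eq v v' -> braid_eq (u ++ v) (u' ++ v')
| braid_eq_cancel (l : letter n) : braid_eq [:: l; inv_letter l] [::]
| braid_eq_far (i j : 'I_n.-1) :
    (i.+2 <= j)%N ->
    braid_eq [:: (i, true); (j, true)] [:: (j, true); (i, true)]
| braid_eq_braid (i j : 'I_n.-1) :
    j = i.+1 :> nat ->
    braid_eq [:: (i, true); (j, true); (i, true)]
             [:: (j, true); (i, true); (j, true)].

Definition braid_rel (n : nat) : rel (word n) := fun u v => `[< braid_eq u v >].

Lemma braid_rel_refl n : reflexive (@braid_rel n).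
Proof. by move=> u; apply/asboolP; constructor. Qed.

Lemma braid_rel_sym n : symmetric (@braid_rel n).
Proof. by move=> u v; apply/asboolP/asboolP => ?; constructor. Qed.

Lemma braid_rel_trans n : transitive (@braid_rel n).
Proof.
move=> v u w /asboolP uv /asboolP vw; apply/asboolP.
exact: braid_eq_trans uv vw.
Qed.

Canonical braid_equiv (n : nat) : equiv_rel (word n) :=
  EquivRel (@braid_rel n) (@braid_rel_refl n) (@braid_rel_sym n)
    (@braid_rel_trans n).

Definition braid (n : nat) : Type := {eq_quot @braid_equiv n}.
HB.instance Definition _ n := Choice.on (braid n).
HB.instance Definition _ n := EqQuotient.on (braid n).

Definition braid_of n (w : word n) : braid n := \pi_(braid n) w.

Lemma braid_ofP n (u v : word n) : braid_of u = braid_of v <-> braid_eq u v.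
Proof. by split=> [/eqmodP/asboolP|uv]; last apply/eqmodP/asboolP. Qed.

Definition braid_mul n (x y : braid n) : braid n :=
  braid_of (repr x ++ repr y).
Definition braid_inv n (x : braid n) : braid n := braid_of (inv_word (repr x)).

Lemma repr_braid_of n (w : word n) : braid_eq (repr (braid_of w)) w.
Proof. by apply/braid_ofP; rewrite /braid_of reprK. Qed.

Lemma braid_ofE n (x : braid n) : x = braid_of (repr x).
Proof. by rewrite /braid_of reprK. Qed.

Lemma braid_mul_of n (u v : word n) :
  braid_mul (braid_of u) (braid_of v) = braid_of (u ++ v).
Proof. by apply/braid_ofP/braid_eq_cat; apply: repr_braid_of. Qed.

Lemma inv_letterK n : involutive (@inv_letter n).
Proof. by case=> i b; rewrite /inv_letter /= negbK. Qed.

Lemma inv_word_cat n (u v : word n) :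
  inv_word (u ++ v) = inv_word v ++ inv_word u.
Proof. by rewrite /inv_word map_cat rev_cat. Qed.

Lemma inv_wordK n : involutive (@inv_word n).
Proof.
by move=> w; rewrite /inv_word map_rev revK (mapK (@inv_letterK n)).
Qed.

Lemma cat_inv_word n (w : word n) : braid_eq (w ++ inv_word w) [::].
Proof.
elim: w => [|l w IHw]; first exact: braid_eq_refl.
rewrite -cat1s inv_word_cat -catA (catA w).
apply: braid_eq_trans (braid_eq_cancel l).
rewrite -[X in braid_eq _ X]cat1s; apply: braid_eq_cat.
  exact: braid_eq_refl.
rewrite -[X in braid_eq _ X]cat0s; apply: braid_eq_cat => //.
exact: braid_eq_refl.
Qed.

Lemma inv_word_catl n (w : word n) : braid_eq (inv_word w ++ w) [::].
Proof. by rewrite -{2}(inv_wordK w); apply: cat_inv_word. Qed.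

Lemma braid_mulA n : associative (@braid_mul n).
Proof.
move=> x y z; rewrite (braid_ofE x) (braid_ofE y) (braid_ofE z).
by rewrite !braid_mul_of catA.
Qed.

Lemma braid_mul1 n : left_id (braid_of [::]) (@braid_mul n).
Proof. by move=> x; rewrite (braid_ofE x) braid_mul_of. Qed.

Lemma braid_mulr1 n : right_id (braid_of [::]) (@braid_mul n).
Proof. by move=> x; rewrite (braid_ofE x) braid_mul_of cats0. Qed.

Lemma braid_mulV n : left_inverse (braid_of [::]) (@braid_inv n) (@braid_mul n).
Proof.
move=> x; rewrite {2}(braid_ofE x) braid_mul_of.
exact/braid_ofP/inv_word_catl.
Qed.

Lemma braid_mulrV n :
  right_inverse (braid_of [::]) (@braid_inv n) (@braid_mul n).
Proof.
move=> x; rewrite {1}(braid_ofE x) braid_mul_of.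
exact/braid_ofP/cat_inv_word.
Qed.

HB.instance Definition _ n := isGroup.Build (braid n)
  (@braid_mulA n) (@braid_mul1 n) (@braid_mulr1 n)
  (@braid_mulV n) (@braid_mulrV n).

Definition sigma n (i : 'I_n.-1) : braid n := braid_of [:: (i, true)].

Definition is_subgroup (G : groupType) (H : set G) : Prop :=
  [/\ H 1, forall x y, H x -> H y -> H (x * y) & forall x, H x -> H x^-1].

Definition generated (G : groupType) (S : set G) : set G :=
  smallest (@is_subgroup G) S.

Definition standard_parabolic n (P : set (braid n)) : Prop :=
  exists I : {set 'I_n.-1}, P = generated [set sigma i | i in [set` I]].

Definition parabolic n (A : set (braid n)) : Prop :=
  exists (P : set (braid n)) (c : braid n),
    standard_parabolic P /\ A = [set x ^ c | x in P].

Definition double_coset (G : groupType) (A : set G) (g : G) (B : set G) :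
    set G :=
  [set h | exists a b, [/\ A a, B b & h = a * g * b]].

(* Model of computation: Kleene's partial mu-recursive functions, given by    *)
(* programs; recfun k is the type of programs with k inputs.                  *)
Inductive recfun : nat -> Type :=
| RZero k : recfun k
| RSucc : recfun 1
| RProj k (i : 'I_k) : recfun k
| RComp k m (f : recfun m) (g : 'I_m -> recfun k) : recfun k
| RPrec k (f : recfun k) (g : recfun k.+2) : recfun k.+1
| RMu k (f : recfun k.+1) : recfun k.

(* computes f v y: on input v the program f halts with output y.              *)
(* In RPrec the recursion is on the first input, s is the sequence of the     *)
(* intermediate values, and the step g receives the index, then the previous  *)
(* value, then the parameters. In RMu the search is on the first input of f,  *)
(* whose values before y have to be defined and nonzero.                      *)
Fixpoint computes k (f : recfun k) : k.-tuple nat -> nat -> Prop :=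
  match f in recfun k return k.-tuple nat -> nat -> Prop with
  | RZero k => fun v y => y = 0%N
  | RSucc => fun v y => y = (thead v).+1
  | RProj k i => fun v y => y = tnth v i
  | RComp k m f g => fun v y =>
      exists w : m.-tuple nat,
        (forall i, computes (g i) v (tnth w i)) /\ computes f w y
  | RPrec k f g => fun v y =>
      let p : k.-tuple nat := [tuple of behead v] in
      exists s : nat -> nat,
        [/\ computes f p (s 0%N),
            forall i, (i < thead v)%N ->
              computes g [tuple of i :: s i :: p] (s i.+1)
          & y = s (thead v)]
  | RMu k f => fun v y =>
      computes f [tuple of y :: v] 0%N /\
      forall i, (i < y)%N -> exists z, computes f [tuple of i :: v] z.+1
  end.

Lemma computes_functional k (f : recfun k) (v : k.-tuple nat) y z :
  computes f v y -> computes f v z -> y = z.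
Proof.
elim: f v y z => {k} [k||k i|k m f IHf g IHg|k f IHf g IHg|k f IHf] v y z /=.
- by move=> -> ->.
- by move=> -> ->.
- by move=> -> ->.
- move=> [w [gw fw]] [w' [gw' fw']].
  suff ww' : w = w' by rewrite -ww' in fw'; apply: IHf fw fw'.
  by apply: eq_from_tnth => i; apply: IHg (gw i) (gw' i).
- move=> [s [s0 sS ->]] [t [t0 tS ->]].
  suff st i : (i <= thead v)%N -> s i = t i by apply: st.
  elim: i => [_|i IHi lt_i]; first exact: IHf s0 t0.
  have ti := tS i lt_i; rewrite -(IHi (ltnW lt_i)) in ti.
  exact: IHg (sS i lt_i) ti.
- move=> [fy ltP] [fz ltP']; case: (ltngtP y z) => // lt.
    by have [u /(IHf _ _ _ fy)] := ltP' _ lt.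
  by have [u /(IHf _ _ _ fz)] := ltP _ lt.
Qed.

(* Words are presented to programs as natural numbers: sigma_(i+1) is coded   *)
(* by 2i, its inverse by 2i + 1, and sequences of numbers are coded by the    *)
(* bijection CodeSeq.code between seq nat and nat.                            *)
Definition code_letter n (l : letter n) : nat := (l.1.*2 + ~~ l.2)%N.
Definition code_word n (w : word n) : nat := CodeSeq.code (map (@code_letter n) w).

Definition double_coset_problem_solvable n (A B : set (braid n)) : Prop :=
  exists p : recfun 2, forall g h : word n,
    let input := [tuple code_word g; code_word h] in
    (double_coset A (braid_of g) B (braid_of h) -> computes p input 1%N) /\
    (~ double_coset A (braid_of g) B (braid_of h) -> computes p input 0%N).

(* Main.v *)
Require Import Defs.
From Stdlib Require Import Setoid Morphisms.
From mathcomp Require Import all_boot zify.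
From mathcomp Require Import boolp classical_sets.

(** The problem is turned into reachability in a finite graph of words whose
    size is computable from the input.

    Positive words modulo the braid relations form a monoid M.  Garside's lemma
    [peq_consP] describes the words that start with two given letters; it makes
    M cancellative with least common multiples of elements that have a common
    multiple, hence with greatest common divisors ([lcm_exists], [gcd_exists]).
    The full twist N is central and divisible by every letter, so that the
    braid group is M with N inverted and M embeds in it ([to_word_inj]).  The
    letters of a set I have a full twist of their own with the same property
    among them, so every element of the standard parabolic subgroup of I is a
    fraction u^-1 v with u, v positive words in I, and cancelling the gcd makes
    u and v coprime.

    Let I, J be the sets of letters and c, d the conjugating braids that define
    A and B.  Replacing g, h by c g d^-1, c h d^-1 and multiplying by a large power of the central N, one has to compare
    positive m and m' that divide some power N^r, and they are equivalent when
    m' = u^-1 v m x^-1 y for positive words u, v in I and x, y in J, which can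
    be taken coprime in pairs.  Put e = v m x^-1 = u m' y^-1.  Both e x and e y
    are positive and x, y are coprime, so e is positive; and e divides both
    u N^r and v N^r, with u, v coprime, so e divides N^r ([common_ancestor]).
    It remains to join e to m, where v m = e x (and likewise m' to e).  With
    p = gcd(v, N) and z = gcd(x, N), the element p^-1 e z is again positive and
    again divides N^r ([convex_step]).  Iterating, e is joined to m by adding
    or removing single letters of I on the left and of J on the right, while
    the words never get longer than r + 1 copies of N ([convex_path]).

    Consequently h is in A g B exactly when h can be reached from g by
    elementary moves through words of length linear in the lengths of g and h
    ([double_coset_conn]).  Such a reachability is decided by a formula with
    bounded quantifiers: every set of codes below a bound that contains the
    code of g and is closed under the moves contains the code of h.  A set is
    coded by the binary digits of a number, and concatenation of words is
    expressed on codes by addition, multiplication and powers of 2, so this is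
    a formula of bounded arithmetic, whose truth value is computed by a
    recursive function ([computable_eval], [decide_connected]). *)

Set Implicit Arguments.
Unset Strict Implicit.
Unset Printing Implicit Defensive.

(** * Positive braid words and Garside's lemma *)

(** Letters are natural numbers, so that all the braid monoids are submonoids
    of one monoid on infinitely many strands; ranges and subsets of letters are
    imposed by [all]. *)
Definition far (i j : nat) : bool := (i.+1 < j) || (j.+1 < i).
Definition adj (i j : nat) : bool := (i == j.+1) || (j == i.+1).

Lemma far_sym i j : far i j -> far j i. Proof. by rewrite /far orbC. Qed.
Lemma adj_sym i j : adj i j -> adj j i. Proof. by rewrite /adj orbC. Qed.

Variant letters_spec (i j : nat) : Prop :=
| LettersEq of i = j
| LettersFar of far i j & i != j & ~~ adj i j
| LettersAdj of adj i j & i != j.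

Lemma lettersP i j : letters_spec i j.
Proof.
have [->|ne] := eqVneq i j; first by constructor.
have [a|na] := boolP (adj i j); first by constructor 3.
by constructor 2 => //; move: ne na; rewrite /far /adj; lia.
Qed.

Inductive pstep : seq nat -> seq nat -> Prop :=
| pstep_far i j u : far i j -> pstep (i :: j :: u) (j :: i :: u)
| pstep_braid i j u : adj i j -> pstep (i :: j :: i :: u) (j :: i :: j :: u)
| pstep_cons i u v : pstep u v -> pstep (i :: u) (i :: v).

(** The length of the chain is kept because Garside's lemma is proved by
    induction on it. *)
Inductive pchain : nat -> seq nat -> seq nat -> Prop :=
| pchain0 u : pchain 0 u u
| pchainS k u v w : pstep u v -> pchain k v w -> pchain k.+1 u w.

Definition peq (u v : seq nat) : Prop := exists k, pchain k u v.
Notation "u =+ v" := (peq u v) (at level 70, no associativity).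

Lemma pstep_sym u v : pstep u v -> pstep v u.
Proof.
by elim=> [i j w /far_sym|i j w /adj_sym|i {}u {}v _]; constructor.
Qed.

Lemma pchain_cat k l u v w : pchain k u v -> pchain l v w -> pchain (k + l) u w.
Proof.
elim=> // {}k {}u {}v x uv _ IH /IH; exact: pchainS.
Qed.

Lemma peq_refl : Reflexive peq.
Proof. by move=> u; exists 0; constructor. Qed.

Lemma peq_trans : Transitive peq.
Proof. by move=> u v w [k uv] [l vw]; exists (k + l); apply: pchain_cat uv vw. Qed.

Lemma peq_step u v : pstep u v -> u =+ v.
Proof. by move=> s; exists 1; apply: pchainS s (pchain0 _). Qed.

Lemma peq_sym : Symmetric peq.
Proof.
move=> u v [k]; elim=> {k u v} [u|k u v w uv _ IH]; first exact: peq_refl.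
exact: peq_trans IH (peq_step (pstep_sym uv)).
Qed.

#[export] Instance peq_equiv : Equivalence peq :=
  Build_Equivalence _ peq_refl peq_sym peq_trans.
#[export] Hint Extern 0 (peq _ _) => apply: peq_refl : core.

Lemma peq_elim (R : seq nat -> seq nat -> Prop) :
  (forall u, R u u) -> (forall u v w, R u v -> R v w -> R u w) ->
  (forall u v, pstep u v -> R u v) -> forall u v, u =+ v -> R u v.
Proof.
move=> rr rt rs u v [k]; elim=> // {}k {}u {}v w uv _; apply: rt; exact: rs.
Qed.

Lemma peq_cons i u v : u =+ v -> i :: u =+ i :: v.
Proof.
elim/peq_elim: u v / => // [u v w uv vw|u v s]; first by etransitivity; eauto.
by apply: peq_step; constructor.
Qed.

Lemma pstep_catr u v w : pstep u v -> pstep (u ++ w) (v ++ w).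
Proof. by elim=> *; constructor. Qed.

#[export] Instance cons_peq : Proper (eq ==> peq ==> peq) (@cons nat).
Proof. by move=> i _ <- u v; apply: peq_cons. Qed.

#[export] Instance cat_peq : Proper (peq ==> peq ==> peq) (@cat nat).
Proof.
move=> u u' uu v v' vv; transitivity (u ++ v').
  by elim: u {uu} => //= i u IH; rewrite IH.
elim/peq_elim: u u' / uu => [//|u x w uv vw|u x s].
  by etransitivity; eauto.
exact/peq_step/pstep_catr.
Qed.

Lemma peq_far i j u : far i j -> i :: j :: u =+ j :: i :: u.
Proof. by move=> f; apply/peq_step; constructor. Qed.

Lemma peq_braid i j u : adj i j -> i :: j :: i :: u =+ j :: i :: j :: u.
Proof. by move=> f; apply/peq_step; constructor. Qed.

Lemma peq_size u v : u =+ v -> size u = size v.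
Proof.
elim/peq_elim: u v / => // [u v w -> //|u v].
by elim=> //= i {}u {}v _ ->.
Qed.

Lemma peq_mem u v : u =+ v -> u =i v.
Proof.
elim/peq_elim: u v / => // [u v w uv vw x|u v]; first by rewrite uv.
elim=> [i j {}u _|i j {}u _|i {}u {}v _ IH] x; rewrite !inE ?IH //.
- by case: (x == i); case: (x == j).
- by case: (x == i); case: (x == j).
Qed.

Lemma peq_all (P : pred nat) u v : u =+ v -> all P u = all P v.
Proof. by move/peq_mem/eq_all_r->. Qed.

(** The words [a :: compl a b] and [b :: compl b a] represent the least common
    multiple of the letters a and b. *)
Definition compl (a b : nat) : seq nat :=
  if a == b then [::] else if adj a b then [:: b; a] else [:: b].

Lemma compl_eq a : compl a a = [::]. Proof. by rewrite /compl eqxx. Qed.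
Lemma compl_adj a b : adj a b -> compl a b = [:: b; a].
Proof. by rewrite /compl => ab; rewrite ab; case: eqP ab => // ->; rewrite /adj; lia. Qed.
Lemma compl_far a b : far a b -> compl a b = [:: b].
Proof.
case: (lettersP a b) => [->|_ /negPf ne /negPf na _|].
- by rewrite /far; lia.
- by rewrite /compl ne na.
- by rewrite /far /adj; lia.
Qed.

Lemma compl_lcm a b : a :: compl a b =+ b :: compl b a.
Proof.
case: (lettersP a b) => [->|f _ _|f _] //.
  by rewrite !compl_far; [apply: peq_far|apply: far_sym|].
by rewrite !compl_adj; [apply: peq_braid|apply: adj_sym|].
Qed.

(** The conclusion of Garside's lemma: the common value of a X and b Y is a
    multiple of the least common multiple of a and b. *)
Definition splits a X b Y :=
  exists Z, X =+ compl a b ++ Z /\ Y =+ compl b a ++ Z.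

Lemma pstep_splits a X b Y : pstep (a :: X) (b :: Y) -> splits a X b Y.
Proof.
move=> s; inversion s as [i j u f|i j u f|i u v f]; subst.
- by exists u; rewrite !compl_far //; apply: far_sym.
- by exists u; rewrite !compl_adj //; apply: adj_sym.
- by exists Y; rewrite compl_eq; split=> //; apply: peq_step.
Qed.

(** Chains of relations are cut at a word c V strictly between a X and b Y.  The
    two halves give two descriptions of V, which are compared by the lemma for
    shorter words; this is the hypothesis [IH] below. *)
Section Combine.
Variable n : nat.
Hypothesis IH : forall a X b Y, size X < n -> a :: X =+ b :: Y -> splits a X b Y.

Let canc a X Y : size X < n -> a :: X =+ a :: Y -> X =+ Y.
Proof.
by move=> lt /(IH lt) [Z]; rewrite compl_eq /= => -[XZ YZ]; rewrite XZ YZ.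
Qed.

Let canc_cat p X Y : size (p ++ X) <= n -> p ++ X =+ p ++ Y -> X =+ Y.
Proof.
elim: p => //= i p IHp lt e; apply: IHp; first exact: ltnW.
exact: (canc lt e).
Qed.

(** The case a = b is cancellation.  Otherwise the position of c relative to a
    and b decides which words the two descriptions of V start with; the shorter
    instances of the lemma are applied until X and Y are both expressed by a
    common tail, and the braid relations among a, b, c then move the required
    complements to the front. *)
Lemma splits_trans a X c V b Y :
  size X = n -> size V = n -> size Y = n ->
  splits a X c V -> splits c V b Y -> splits a X b Y.
Proof.
move=> sX sV sY [Z [XZ VZ]] [Z' [VZ' YZ']].
have VV : compl c a ++ Z =+ compl c b ++ Z' by rewrite -VZ.
have sXZ := peq_size XZ; have sVZ := peq_size VZ; have sVZ' := peq_size VZ'.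
have sYZ := peq_size YZ'.
have [eab|nab] := eqVneq a b.
  have ZZ : Z =+ Z'.
    by apply: (@canc_cat (compl c a)); rewrite -?(peq_size VZ) ?sV // {2}eab.
  by exists Y; rewrite eab compl_eq /=; split=> //; rewrite XZ YZ' ZZ eab.
case: (lettersP a c) XZ VZ VV sXZ sVZ => [->|ac nac jac|ac nac].
- rewrite compl_eq /= => XZ VZ VV sXZ sVZ.
  by exists Z'; split=> //; rewrite XZ VV.
- have ca := far_sym ac; rewrite (compl_far ac) (compl_far ca) /= => XZ VZ.
  case: (lettersP c b) VZ' YZ' sVZ' sYZ => [<-|cb ncb jcb|cb ncb].
  + rewrite compl_eq /= => VZ' YZ' sVZ' sYZ VV sXZ sVZ.
    by exists Z; rewrite !compl_far //; split=> //; rewrite YZ' -VV.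
  (* c commutes with a and b, hence with their complements *)
  + have bc := far_sym cb; rewrite (compl_far cb) (compl_far bc) /= => VZ' YZ' sVZ' sYZ VV sXZ sVZ.
    have lt : size Z < n by lia.
    have [W [ZW ZW']] := IH lt VV.
    have comm d e : far c d -> far c e -> c :: (compl d e ++ W) =+ compl d e ++ c :: W.
      move=> fd fe; case: (lettersP d e) => [->|f _ _|f _]; first by rewrite compl_eq.
        by rewrite compl_far //= peq_far.
      by rewrite compl_adj //= peq_far // [c :: d :: _]peq_far.
    by exists (c :: W); split; [rewrite XZ ZW|rewrite YZ' ZW']; apply: comm.
  + have bc := adj_sym cb; rewrite (compl_adj cb) (compl_adj bc) /= => VZ' YZ' sVZ' sYZ VV sXZ sVZ.
    have lt : size Z < n by lia.
    have [W [ZW ZW']] := IH lt VV.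
    case: (lettersP a b) ZW ZW' => [eab|ab _ _|ab _].
    * by rewrite eab eqxx in nab.
    * have ba := far_sym ab; rewrite (compl_far ab) (compl_far ba) /= => ZW ZW'.
      have lt' : size Z' < n by lia.
      have [W1] := IH lt' ZW'; rewrite !compl_far //= => -[Z1 WW1].
      exists (c :: b :: W1); rewrite !compl_far //=; split.
        by rewrite XZ ZW WW1 peq_braid.
      by rewrite YZ' Z1 [b :: a :: _]peq_far // peq_far.
    (* b is the middle letter of three consecutive ones *)
    * have ba := adj_sym ab; rewrite (compl_adj ab) (compl_adj ba) /= => ZW ZW'.
      have lt' : size Z' < n by lia.
      have [W1] := IH lt' ZW'; rewrite !compl_far //= => -[Z1 WW1].
      have lt'' : size W < n by move: (peq_size ZW) => /=; lia.
      have [W2] := IH lt'' WW1; rewrite !compl_adj //= => -[WW2 W12].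
      exists (c :: b :: a :: W2); rewrite (compl_adj ab) (compl_adj ba) /=; split.
        rewrite XZ ZW WW2 [a :: c :: _]peq_far // [c :: b :: c :: _]peq_braid //.
        by rewrite [b :: a :: b :: _]peq_braid // [c :: a :: _]peq_far.
      rewrite YZ' Z1 W12 [b :: a :: b :: _]peq_braid // [c :: a :: _]peq_far //.
      by rewrite [a :: c :: W2]peq_far // [c :: b :: c :: _]peq_braid.
- have ca := adj_sym ac; rewrite (compl_adj ac) (compl_adj ca) /= => XZ VZ.
  case: (lettersP c b) VZ' YZ' sVZ' sYZ => [<-|cb ncb jcb|cb ncb].
  + rewrite compl_eq /= => VZ' YZ' sVZ' sYZ VV sXZ sVZ.
    by exists Z; rewrite !compl_adj //; split=> //; rewrite YZ' -VV.
  + have bc := far_sym cb; rewrite (compl_far cb) (compl_far bc) /= => VZ' YZ' sVZ' sYZ VV sXZ sVZ.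
    have lt : size (c :: Z) < n by move: sXZ sX => /=; lia.
    have [W [ZW ZW']] := IH lt VV.
    case: (lettersP a b) ZW ZW' => [eab|ab _ _|ab _].
    * by rewrite eab eqxx in nab.
    * have ba := far_sym ab; rewrite (compl_far ab) (compl_far ba) /= => ZW ZW'.
      have lt' : size Z < n by move: sXZ sX => /=; lia.
      have [W1] := IH lt' ZW; rewrite !compl_far //= => -[Z1 WW1].
      exists (c :: a :: W1); rewrite !compl_far //=; split.
        by rewrite XZ Z1 [a :: b :: _]peq_far // peq_far.
      by rewrite YZ' ZW' WW1 [c :: a :: c :: _]peq_braid.
    (* a is the middle letter: the mirror image of the previous such case *)
    * have ba := adj_sym ab; rewrite (compl_adj ab) (compl_adj ba) /= => ZW ZW'.
      have lt' : size Z < n by move: sXZ sX => /=; lia.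
      have [W1] := IH lt' ZW; rewrite !compl_far //= => -[Z1 WW1].
      have lt'' : size W < n by move: (peq_size ZW) sXZ sX => /=; lia.
      have [W2] := IH lt'' WW1; rewrite !compl_adj //= => -[WW2 W12].
      exists (c :: a :: b :: W2); rewrite (compl_adj ab) (compl_adj ba) /=; split.
        rewrite XZ Z1 W12 [a :: b :: a :: _]peq_braid // [c :: b :: _]peq_far //.
        by rewrite [b :: c :: W2]peq_far // [c :: a :: c :: _]peq_braid.
      rewrite YZ' ZW' WW2 [b :: c :: _]peq_far // [c :: a :: c :: _]peq_braid //.
      by rewrite [a :: b :: a :: _]peq_braid // [c :: b :: _]peq_far.
  + have bc := adj_sym cb; rewrite (compl_adj cb) (compl_adj bc) /= => VZ' YZ' sVZ' sYZ VV sXZ sVZ.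
    have lt : size (c :: Z) < n by move: sXZ sX => /=; lia.
    have [W [ZW ZW']] := IH lt VV.
    case: (lettersP a b) ZW ZW' => [eab|ab _ _|ab _].
    * by rewrite eab eqxx in nab.
    (* c is the middle letter *)
    * have ba := far_sym ab; rewrite (compl_far ab) (compl_far ba) /= => ZW ZW'.
      have lt1 : size Z < n by move: sXZ sX => /=; lia.
      have lt2 : size Z' < n by move: sYZ sY => /=; lia.
      have [W1] := IH lt1 ZW; rewrite !compl_adj //= => -[Z1 WW1].
      have [W2] := IH lt2 ZW'; rewrite !compl_adj //= => -[Z2 WW2].
      have lt3 : size (b :: W1) < n.
        by move: (peq_size Z1) sXZ sX => /=; lia.
      have e : b :: W1 =+ a :: W2 by apply: (@canc c) => //; rewrite -WW1.
      have [W3] := IH (ltnW lt3) e; rewrite !compl_far //= => -[e1 e2].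
      exists (c :: b :: a :: c :: W3); rewrite !compl_far //=; split.
        rewrite XZ Z1 e1 [a :: b :: _]peq_far // [a :: c :: a :: _]peq_braid //.
        by rewrite [c :: b :: c :: _]peq_braid.
      rewrite YZ' Z2 e2 [b :: a :: _]peq_far // [b :: c :: b :: _]peq_braid //.
      by rewrite [c :: a :: c :: _]peq_braid // [a :: b :: _]peq_far.
    (* no three letters are pairwise adjacent *)
    * by move: ac cb ab; rewrite /adj; lia.
Qed.
End Combine.

(** Garside's lemma, by induction on the length of the words and then on the
    number of relations applied: a single relation gives it at once, and longer
    chains are composed by [splits_trans]. *)
Lemma peq_consP a X b Y : a :: X =+ b :: Y -> splits a X b Y.
Proof.
elim/ltn_ind: {X}(size X) {-2}X (erefl (size X)) a b Y => n IHn X sX a b Y.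
have IH a' X' b' Y' : size X' < n -> a' :: X' =+ b' :: Y' -> splits a' X' b' Y'.
  by move=> lt; apply: IHn lt _ erefl _ _ _.
case=> k; elim: k a X sX => [|k IHk] a X sX ch.
  by inversion ch; subst; exists Y; rewrite compl_eq.
inversion ch as [|k' u W v st ch']; subst.
case: W st ch' => [|c V] st ch'; first by inversion st.
have sV : size V = size X by case: (peq_size (peq_step st)).
have sY : size Y = size X.
  by rewrite -sV; case: (peq_size (ex_intro _ k ch' : peq _ _)).
apply: (splits_trans IH erefl sV sY (pstep_splits st)).
exact: IHk ch'.
Qed.

Lemma peq_consI i u v : i :: u =+ i :: v -> u =+ v.
Proof.
by move=> /peq_consP[Z]; rewrite compl_eq /= => -[uZ vZ]; rewrite uZ vZ.
Qed.

Lemma peq_catI p u v : p ++ u =+ p ++ v -> u =+ v.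
Proof. by elim: p => //= i p IHp /peq_consI. Qed.

(** * Divisibility, least common multiples and greatest common divisors *)

(** The common multiple is recorded through its two complements c and d. *)
Definition is_lcm (u v c d : seq nat) : Prop :=
  u ++ c =+ v ++ d /\
  forall c' d', u ++ c' =+ v ++ d' -> exists z, c' =+ c ++ z /\ d' =+ d ++ z.

(** Two elements with a common multiple have a least one.  Starting from the
    complements of the first letters, the diagram with sides s u and t v is
    filled by three smaller ones; the given common multiple bounds the sizes
    and makes the induction terminate. *)
Lemma lcm_exists u v a b : u ++ a =+ v ++ b -> exists c d, is_lcm u v c d.
Proof.
elim/ltn_ind: {u a}(size (u ++ a)) {-2}u {-2}a (erefl (size (u ++ a))) v b.
move=> n IHn u a sn v b.
have {}IHn u' v' a' b' : size (u' ++ a') < n -> u' ++ a' =+ v' ++ b' ->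
    exists c d, is_lcm u' v' c d.
  by move=> lt; apply: IHn lt _ _ erefl _ _.
case: u sn => [|s u] sn.
  exists v, [::]; split=> [|c' d' /= e]; first by rewrite cats0.
  by exists d'; split; [exact: e|].
case: v => [|t v].
  exists [::], (s :: u); split=> [|c' d' /= e]; first by rewrite cats0.
  by exists c'; split; [|symmetry; exact: e].
move=> /= /peq_consP [z [uz vz]].
have size_u : size (u ++ a) < n by rewrite -sn.
have size_z : size (compl s t ++ z) < n by rewrite -(peq_size uz).
have size_v : size (v ++ b) < n.
  rewrite (peq_size vz); move: size_z (peq_size (compl_lcm s t)) => /=.
  by rewrite !size_cat; lia.
have [c1 [d1 [e1 univ1]]] := IHn _ _ _ _ size_u uz.
have [c2 [d2 [e2 univ2]]] := IHn _ _ _ _ size_v vz.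
have [f1 [_ zf1]] := univ1 _ _ uz; have [f2 [_ zf2]] := univ2 _ _ vz.
have size_z' : size (d1 ++ f1) < n.
  by rewrite -(peq_size zf1); move: size_z; rewrite size_cat; lia.
have df : d1 ++ f1 =+ d2 ++ f2 by rewrite -zf1.
have [c3 [d3 [e3 univ3]]] := IHn _ _ _ _ size_z' df.
exists (c1 ++ c3), (c2 ++ d3); split=> [|c' d' /= /peq_consP[y [uy vy]]].
  rewrite !catA /= e1 e2 -!catA e3.
  exact: (cat_peq (compl_lcm s t) (peq_refl _)).
have [g1 [cg1 yg1]] := univ1 _ _ uy; have [g2 [dg2 yg2]] := univ2 _ _ vy.
have [h [gh1 gh2]] : exists h, g1 =+ c3 ++ h /\ g2 =+ d3 ++ h.
  by apply: univ3; rewrite -yg1.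
by exists h; rewrite -!catA -gh1 -gh2.
Qed.

Definition ldiv (u v : seq nat) : Prop := exists w, u ++ w =+ v.

#[export] Instance ldiv_peq : Proper (peq ==> peq ==> iff) ldiv.
Proof.
move=> u u' uu v v' vv; split=> -[w e]; exists w; first by rewrite -uu e.
by rewrite uu e vv.
Qed.

Lemma ldiv_refl u : ldiv u u. Proof. by exists [::]; rewrite cats0. Qed.
Lemma ldiv_trans v u w : ldiv u v -> ldiv v w -> ldiv u w.
Proof. by move=> [a ua] [b vb]; exists (a ++ b); rewrite catA ua. Qed.
Lemma ldiv_catr u v : ldiv u (u ++ v). Proof. by exists v. Qed.
Lemma ldiv_cat p u v : ldiv (p ++ u) (p ++ v) <-> ldiv u v.
Proof.
split=> -[w e]; exists w; last by rewrite -catA e.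
by apply: (@peq_catI p); rewrite catA.
Qed.
Lemma ldiv_size u v : ldiv u v -> size u <= size v.
Proof. by move=> [w /peq_size <-]; rewrite size_cat leq_addr. Qed.
(** A common divisor d of maximal length.  The last property contains the
    compatibility of gcds with left multiplication, w gcd(u, v) =
    gcd(w u, w v): if e divides w u and w v, then so does the lcm w f of e and
    w, hence f divides u and v; the lcm of d and f divides them too, so by
    maximality it is d, and f divides d. *)
Lemma gcd_exists u v : exists d, [/\ ldiv d u, ldiv d v &
  forall w e, ldiv e (w ++ u) -> ldiv e (w ++ v) -> ldiv e (w ++ d)].
Proof.
pose P k := `[< exists d, [/\ ldiv d u, ldiv d v & size d = k] >].
have P0 : exists k, P k by exists 0; apply/asboolP; exists [::]; split; eexists.
have Pu k : P k -> k <= size u by move=> /asboolP[d [/ldiv_size + _ <-]].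
have [k /asboolP[d [du dv dk]] kmax] := ex_maxnP P0 Pu.
exists d; split=> // w e [x ex] [y ey].
have [c [f [cf univ]]] := lcm_exists ex.
have [z [_ uz]] := univ _ _ ex; have [z' [_ vz]] := univ _ _ ey.
have [z1 dz1] := du; have [z2 dz2] := dv.
have [c' [f' [cf' univ']]] : exists c' f', is_lcm d f c' f'.
  by apply: (lcm_exists (a := z1) (b := z)); rewrite dz1 uz.
have [g1 [_ zg1]] : exists g, z1 =+ c' ++ g /\ z =+ f' ++ g.
  by apply: univ'; rewrite dz1 uz.
have [g2 [_ zg2]] : exists g, z2 =+ c' ++ g /\ z' =+ f' ++ g.
  by apply: univ'; rewrite dz2 vz.
have : size (d ++ c') <= k.
  apply: kmax; apply/asboolP; exists (d ++ c'); split=> //.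
    by exists g1; rewrite cf' -catA -zg1 uz.
  by exists g2; rewrite cf' -catA -zg2 vz.
rewrite size_cat dk -{2}[k]addn0 leq_add2l leqn0 => /nilP c'0.
have df : d =+ f ++ f' by rewrite -cf' c'0 cats0.
apply: (@ldiv_trans (w ++ f)); first by exists c.
by apply/ldiv_cat; rewrite df; apply: ldiv_catr.
Qed.

(** * Full twists and convexity of the divisors of their powers *)

(** Coprime for left divisors only: right divisors may be shared. *)
Definition coprime_words (u v : seq nat) : Prop :=
  forall d, ldiv d u -> ldiv d v -> d = [::].

Lemma coprime_reduce u v :
  exists d u' v', [/\ u =+ d ++ u', v =+ d ++ v' & coprime_words u' v'].
Proof.
have [d [[u' du] [v' dv] univ]] := gcd_exists u v.
exists d, u', v'; split=> [||e eu ev]; try by symmetry.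
have : ldiv (d ++ e) ([::] ++ d).
  by apply: univ => /=; rewrite -?du -?dv; apply/ldiv_cat.
by move/ldiv_size; rewrite size_cat -{2}[size d]addn0 leq_add2l leqn0 => /nilP.
Qed.

(** Euclid's lemma for gcds on the left: e divides w gcd(u, v) = w. *)
Lemma coprime_ldiv u v w e :
  coprime_words u v -> ldiv e (w ++ u) -> ldiv e (w ++ v) -> ldiv e w.
Proof.
move=> cop eu ev; have [d [du dv univ]] := gcd_exists u v.
by have := univ _ _ eu ev; rewrite (cop _ du dv) cats0.
Qed.

Notation commutes u v := (u ++ v =+ v ++ u).

Lemma commutes_catr u v w : commutes u v -> commutes u w -> commutes u (v ++ w).
Proof. by move=> uv uw; rewrite catA uv -catA uw catA. Qed.

Lemma commutes_nil u : commutes u [::]. Proof. by rewrite cats0. Qed.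

Lemma commutes_all (P : pred nat) u v :
  (forall i, P i -> commutes [:: i] v) -> all P u -> commutes u v.
Proof.
move=> Pv; elim: u => [_|i u IHu /= /andP[Pi Pu]].
  by rewrite cats0.
by symmetry; apply: (@commutes_catr v [:: i]); symmetry; auto.
Qed.

Lemma commutes_far i u : all (far i) u -> commutes [:: i] u.
Proof.
move=> /commutes_all H; symmetry; apply: H => j f.
by rewrite /= peq_far //; apply: far_sym.
Qed.

Section FullTwist.
Variable I : pred nat.

(** With strands numbered from 0, the pure braid where strand k+1 goes once around
    the strands that precede it in the run of consecutive letters of I ending
    in k.  These are the Jucys-Murphy elements of that run. *)
Fixpoint jucys_murphy (k : nat) : seq nat :=
  if k is j.+1 then k :: (if I j then jucys_murphy j else [::]) ++ [:: k]
  else [:: 0; 0].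

(** The product of the full twists of the runs of consecutive letters of I below
    k: the Jucys-Murphy elements of a run multiply to its full twist. *)
Fixpoint full_twist (k : nat) : seq nat :=
  if k is j.+1 then full_twist j ++ (if I j then jucys_murphy j else [::])
  else [::].

Lemma jucys_murphy_all k :
  I k -> all (fun i => I i && (i <= k)) (jucys_murphy k).
Proof.
elim: k => [|k IHk] Ik; first by rewrite /= Ik.
rewrite /= all_cat /= Ik leqnn /= andbT; case: ifP => //= /IHk.
by apply: sub_all => i /andP[-> /leqW].
Qed.

Lemma full_twist_all k : all (fun i => I i && (i < k)) (full_twist k).
Proof.
elim: k => //= k IHk; rewrite all_cat; apply/andP; split.
  by apply: sub_all IHk => i /andP[-> /leqW].
by case: ifP => // /jucys_murphy_all.
Qed.

(** The element of k+1 is the element of k between two letters k+1, so letters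
    below k pass through by induction, and for the letter k itself it takes a
    braid relation on either side. *)
Lemma jucys_murphy_commutes i k :
  I i -> I k -> i < k -> commutes [:: i] (jucys_murphy k).
Proof.
elim: k => // k IHk Ii Ik; rewrite ltnS leq_eqVlt /= => /orP[/eqP ik|ik].
  rewrite -{}ik {k IHk} in Ik *; rewrite Ii.
  have a : adj i i.+1 by rewrite /adj eqxx orbT.
  case: i Ii Ik a => [|i] Ii Ik a /=.
    rewrite peq_braid // [[:: 1; 0; 0; 1; 0]](_ : _ = [:: 1; 0] ++ [:: 0; 1; 0]) //.
    by rewrite (peq_braid [::] a).
  set Y := (if I i then _ else _).
  have cY : commutes [:: i.+2] Y.
    apply: commutes_far; rewrite /Y; case: ifP => // /jucys_murphy_all.
    by apply: sub_all => j /andP[_]; rewrite /far; lia.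
  rewrite -!catA /= peq_braid //.
  rewrite -[i.+2 :: Y ++ _]/([:: i.+2] ++ Y ++ [:: i.+1; i.+2]) (catA [:: i.+2]) cY.
  by rewrite -!catA /= (peq_braid [::] (adj_sym a)).
have f : far i k.+1 by rewrite /far; lia.
have c1 : commutes [:: i] [:: k.+1] by apply: commutes_far; rewrite /= f.
set X := (if I k then _ else _).
suff: commutes [:: i] ([:: k.+1] ++ X ++ [:: k.+1]) by [].
do 2?[apply: commutes_catr => //]; rewrite {}/X.
by case: ifP => [Ik'|_]; [exact: IHk|exact: commutes_nil].
Qed.

(** The last letter i commutes with the product A (i A i) of the last two
    Jucys-Murphy elements, because these two commute. *)
Lemma full_twist_central i k : I i -> i < k -> commutes [:: i] (full_twist k).
Proof.
elim: k => // k IHk Ii; rewrite ltnS leq_eqVlt /= => /orP[/eqP ik|ik]; last first.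
  rewrite -[i :: _]/([:: i] ++ _); apply: commutes_catr; first exact: IHk.
  by case: ifP => [Ik|_]; [exact: jucys_murphy_commutes|exact: commutes_nil].
rewrite -{}ik Ii {k IHk}; case: i Ii => [|i] Ii; first by [].
have cf : commutes [:: i.+1] (full_twist i).
  apply: commutes_far; apply: sub_all (full_twist_all i) => j /andP[_].
  by rewrite /far; lia.
pose X := if I i then jucys_murphy i else [::].
suff: commutes [:: i.+1] (full_twist i ++ (X ++ jucys_murphy i.+1)).
  by rewrite -[full_twist i.+1]/(full_twist i ++ X) -!catA.
apply: commutes_catr => //; rewrite {}/X; case: ifP => Ii'; last by rewrite /= Ii'.
have cA : commutes (jucys_murphy i) (jucys_murphy i.+1).
  apply: commutes_all (jucys_murphy_all Ii') => j /andP[Ij ji].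
  exact: jucys_murphy_commutes.
move: cA; rewrite /= Ii'; set A := jucys_murphy i => cA.
transitivity ((i.+1 :: (A ++ [:: i.+1]) ++ A) ++ [:: i.+1]); last by rewrite -cA.
by rewrite /= -!catA.
Qed.

(** The Jucys-Murphy element of i starts with i and can be moved to the front
    of the product of those up to i. *)
Lemma full_twist_ldiv i k : I i -> i < k -> ldiv [:: i] (full_twist k).
Proof.
elim: k => // k IHk Ii; rewrite ltnS leq_eqVlt /= => /orP[/eqP ik|ik]; last first.
  by apply: ldiv_trans (IHk Ii ik) _; exact: ldiv_catr.
rewrite -{}ik Ii {k IHk}.
have cA : commutes (full_twist i) (jucys_murphy i).
  apply: commutes_all (full_twist_all i) => j /andP[Ij ji].
  exact: jucys_murphy_commutes.
rewrite cA; case: i {cA Ii} => [|i] /=.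
  by exists ([:: 0] ++ [::]).
by eexists; rewrite /=; reflexivity.
Qed.

End FullTwist.

Section Convexity.
Variables (S : pred nat) (N : seq nat).
Hypothesis NS : all S N.
Hypothesis N_central : forall i, S i -> commutes [:: i] N.
Hypothesis N_ldiv : forall i, S i -> ldiv [:: i] N.

Definition pow_word (r : nat) : seq nat := flatten (nseq r N).

Lemma pow_wordD r s : pow_word (r + s) = pow_word r ++ pow_word s.
Proof. by rewrite /pow_word nseqD flatten_cat. Qed.

Lemma pow_word_commutes u r : all S u -> commutes u (pow_word r).
Proof.
move=> Su; elim: r => [|r IHr]; first exact: commutes_nil.
by apply: (@commutes_catr _ N) => //; apply: commutes_all Su.
Qed.

Lemma pow_word_all r : all S (pow_word r).
Proof. by elim: r => //= r IHr; rewrite all_cat NS. Qed.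

Lemma size_pow_word r : size (pow_word r) = r * size N.
Proof. by elim: r => //= r IHr; rewrite size_cat IHr mulSn. Qed.

(** Centrality of N lets the cofactor of x move past N^b. *)
Lemma ldiv_powM x y a b : all S y ->
  ldiv x (pow_word a) -> ldiv y (pow_word b) -> ldiv (x ++ y) (pow_word (a + b)).
Proof.
move=> Sy [x' xx] [y' yy]; rewrite pow_wordD.
have Sx' : all S x'.
  by have := pow_word_all a; rewrite -(peq_all S xx) all_cat => /andP[].
rewrite -xx -catA (pow_word_commutes b Sx'); apply/ldiv_cat.
by exists (y' ++ x'); rewrite catA yy.
Qed.

Lemma ldiv_pow_word x : all S x -> ldiv x (pow_word (size x)).
Proof.
elim: x => [_|i x IHx /= /andP[Si Sx]]; first exact: ldiv_refl.
apply: (@ldiv_powM [:: i] x 1) => //; last exact: IHx.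
by rewrite /pow_word /= cats0; apply: N_ldiv.
Qed.

Lemma ldiv_pow_leq x r s : r <= s -> ldiv x (pow_word r) -> ldiv x (pow_word s).
Proof.
by move=> /subnKC <- d; apply: ldiv_trans d _; rewrite pow_wordD; apply: ldiv_catr.
Qed.

(** With f standing for N^j e, both equations say e = v g x^-1 = u h y^-1.
    Euclid's lemma for x, y shows that N^j divides f, so e is positive; the same
    lemma for u, v shows that e divides N^r, as it divides v N^r = N^r v and
    u N^r = N^r u. *)
Lemma common_ancestor j r u v x y f g h :
  all S u -> all S v -> coprime_words u v -> coprime_words x y ->
  f ++ x =+ pow_word j ++ v ++ g -> f ++ y =+ pow_word j ++ u ++ h ->
  ldiv g (pow_word r) -> ldiv h (pow_word r) ->
  exists e, [/\ e ++ x =+ v ++ g, e ++ y =+ u ++ h & ldiv e (pow_word r)].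
Proof.
move=> Su Sv cuv cxy fx fy gr hr.
have [e fe] : ldiv (pow_word j) f.
  by apply: (coprime_ldiv cxy); rewrite ?fx ?fy; apply: ldiv_catr.
have ex : e ++ x =+ v ++ g.
  by apply: (@peq_catI (pow_word j)); rewrite catA fe.
have ey : e ++ y =+ u ++ h.
  by apply: (@peq_catI (pow_word j)); rewrite catA fe.
exists e; split=> //; apply: (coprime_ldiv cuv).
  rewrite -(pow_word_commutes r Su); apply: (@ldiv_trans (u ++ h)).
    by rewrite -ey; apply: ldiv_catr.
  exact/ldiv_cat.
rewrite -(pow_word_commutes r Sv); apply: (@ldiv_trans (v ++ g)).
  by rewrite -ex; apply: ldiv_catr.
exact/ldiv_cat.
Qed.

(** The divisors of N^r are convex for the relation p g = w x, as in the
    conjugacy problem for Garside groups.  With p1 = gcd(p, N) and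
    x1 = gcd(x, N), the element p1 divides w x = p g and also w N = N w, hence
    w x1.  For the upper bound, w x1 divides N^r p, because w x = p g divides
    p N^r, and it divides N^r N because w divides N^r and x1 divides N; so it
    divides N^r p1.  Since every letter divides N, the step is trivial only
    when p and x are empty. *)
Lemma convex_step p g w x r :
  all S p -> all S w -> all S x ->
  p ++ g =+ w ++ x -> ldiv w (pow_word r) -> ldiv g (pow_word r) ->
  exists p1 p' x1 x' w1,
    [/\ p =+ p1 ++ p', x =+ x1 ++ x', w ++ x1 =+ p1 ++ w1,
        p' ++ g =+ w1 ++ x' & ldiv w1 (pow_word r)] /\
    [/\ size x1 <= size N, p1 = [::] -> p = [::] & x1 = [::] -> x = [::]].
Proof.
move=> Sp Sw Sx e wr gr.
have [p1 [[p' pp] p1N univp]] := gcd_exists p N.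
have [x1 [[x' xx] x1N univx]] := gcd_exists x N.
have SN := commutes_all N_central.
have Sp1 : all S p1 by move: Sp; rewrite -(peq_all S pp) all_cat => /andP[].
have [w1 ww] : ldiv p1 (w ++ x1).
  apply: univx; first by rewrite -e -pp -catA; apply: ldiv_catr.
  by apply: ldiv_trans p1N _; rewrite (SN _ Sw); apply: ldiv_catr.
have p'g : p' ++ g =+ w1 ++ x'.
  by apply: (@peq_catI p1); rewrite !catA ww pp e -catA xx.
have w1r : ldiv w1 (pow_word r).
  apply/(@ldiv_cat p1); rewrite ww (pow_word_commutes r Sp1); apply: univp.
    rewrite -(pow_word_commutes r Sp); apply: (@ldiv_trans (p ++ g)).
      by rewrite e -xx catA; apply: ldiv_catr.
    exact/ldiv_cat.
  rewrite -(pow_word_commutes r NS) (_ : commutes N _); last first.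
    exact: pow_word_commutes.
  apply: (@ldiv_trans (w ++ N)); first exact/ldiv_cat.
  by rewrite (SN _ Sw) -(pow_word_commutes r NS); apply/ldiv_cat.
have nilp q d : all S q -> (forall w0 e0, ldiv e0 (w0 ++ q) ->
    ldiv e0 (w0 ++ N) -> ldiv e0 (w0 ++ d)) -> d = [::] -> q = [::].
  case: q => // i q /= /andP[Si Sq] univ d0; subst d.
  have /ldiv_size // : ldiv [:: i] ([::] ++ [::]).
  by apply: univ; [exists q|apply: N_ldiv].
exists p1, p', x1, x', w1; split; split=> //; try by symmetry.
- exact: ldiv_size.
- exact: nilp univp.
- exact: nilp univx.
Qed.

(** The relation E stands for connectedness through words of bounded length; only
    its closure properties matter here. *)
Section ConvexPath.
Variables (PI PJ : pred nat) (r : nat) (E : seq nat -> seq nat -> Prop).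
Hypotheses (PI_S : subpred PI S) (PJ_S : subpred PJ S).
Hypotheses (E_sym : forall u v, E u v -> E v u)
  (E_trans : forall u v w, E u v -> E v w -> E u w).
Hypothesis E_peq : forall u v,
  all S u -> size u <= r.+1 * size N -> u =+ v -> E u v.
Hypothesis E_left : forall s u,
  PI s -> all S u -> size (s :: u) <= r.+1 * size N -> E u (s :: u).
Hypothesis E_right : forall t u,
  PJ t -> all S u -> size (rcons u t) <= r.+1 * size N -> E u (rcons u t).

Lemma convex_path p g w x :
  all PI p -> all S g -> all S w -> all PJ x ->
  p ++ g =+ w ++ x -> ldiv w (pow_word r) -> ldiv g (pow_word r) -> E w g.
Proof.
have [k] := ubnP (size p + size x); elim: k => // k IHk in p x w *.
rewrite ltnS => sk Ip Sg Sw Jx e wr gr.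
have Sp := sub_all PI_S Ip; have Sx := sub_all PJ_S Jx.
have wN : size w <= r * size N by rewrite -size_pow_word; apply: ldiv_size.
have wN' : size w <= r.+1 * size N by rewrite mulSn (leq_trans wN) // leq_addl.
have [p1 [p' [x1 [x' [w1 [[pp xx ww p'g w1r] [x1N np nx]]]]]]] :=
  convex_step Sp Sw Sx e wr gr.
have [|ne] := boolP ((size p1 == 0) && (size x1 == 0)).
  move=> /andP[/nilP/np p0 /nilP/nx x0]; apply: E_peq => //.
  by move: e; rewrite p0 x0 cats0 /= => ->.
have : all PI (p1 ++ p') by rewrite -(peq_all _ pp).
rewrite all_cat => /andP[Ip1 Ip'].
have : all PJ (x1 ++ x') by rewrite -(peq_all _ xx).
rewrite all_cat => /andP[Jx1 Jx'].
have size_wx : size (w ++ x1) <= r.+1 * size N.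
  by rewrite size_cat mulSn addnC leq_add.
have Swx : all S (w ++ x1) by rewrite all_cat Sw (sub_all PJ_S Jx1).
have size_pw : size (p1 ++ w1) <= r.+1 * size N by rewrite -(peq_size ww).
have Spw : all S (p1 ++ w1) by rewrite -(peq_all _ ww).
have Sw1 : all S w1 by move: Spw; rewrite all_cat => /andP[].
have right_path : E w (w ++ x1).
  elim/last_ind: x1 {xx ww x1N nx ne} Jx1 size_wx Swx
    => [_ _ _|y t IHy]; first by rewrite cats0; apply: E_peq.
  rewrite all_rcons -rcons_cat size_rcons all_rcons => /andP[Jt Jy] sy /andP[St Swy].
  by apply: E_trans (IHy Jy (ltnW sy) Swy) _; apply: E_right; rewrite ?size_rcons.
have left_path : E w1 (p1 ++ w1).
  elim: p1 {pp ww np ne} Ip1 size_pw Spw => [_ sw _|s y IHy] /=.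
    exact: E_peq.
  move=> /andP[Is Iy] sy /andP[Ss Syw].
  by apply: E_trans (IHy Iy (ltnW sy) Syw) _; apply: E_left.
apply: E_trans right_path _; apply: E_trans (E_peq Swx size_wx ww) _.
apply: E_trans (E_sym left_path) _; apply: IHk p'g w1r gr => //.
apply: leq_trans sk; rewrite (peq_size pp) (peq_size xx) !size_cat.
rewrite addnACA -add1n leq_add2r.
by move: ne; case: (size p1) => //=; case: (size x1).
Qed.

End ConvexPath.
End Convexity.

(** * Computable functions and bounded arithmetic *)

Definition computable k (F : k.-tuple nat -> nat) : Prop :=
  exists p : recfun k, forall v, computes p v (F v).

Lemma computable_ext k (F G : k.-tuple nat -> nat) :
  F =1 G -> computable F -> computable G.
Proof. by move=> FG [p cp]; exists p => v; rewrite -FG. Qed.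

Lemma computable_proj k (i : 'I_k) : computable (fun v => tnth v i).
Proof. by exists (RProj i). Qed.

Lemma computable_comp k m (F : m.-tuple nat -> nat) (G : 'I_m -> k.-tuple nat -> nat) :
  computable F -> (forall i, computable (G i)) ->
  computable (fun v => F [tuple G i v | i < m]).
Proof.
move=> [p cp] /choice[q cq]; exists (RComp p q) => v /=.
by exists [tuple G i v | i < m]; split=> // i; rewrite tnth_mktuple.
Qed.

Lemma computable_comp1 k (f : nat -> nat) (G : k.-tuple nat -> nat) :
  computable (fun v : 1.-tuple nat => f (thead v)) -> computable G ->
  computable (fun v => f (G v)).
Proof.
move=> cf cG; apply: computable_ext (computable_comp cf (fun=> cG)) => v.
by rewrite /thead tnth_mktuple.
Qed.

Lemma computable_comp2 k (f : nat -> nat -> nat) (G H : k.-tuple nat -> nat) :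
  computable (fun v : 2.-tuple nat => f (thead v) (tnth v (lift ord0 ord0))) ->
  computable G -> computable H -> computable (fun v => f (G v) (H v)).
Proof.
move=> cf cG cH.
have cGH (i : 'I_2) : computable (if i == ord0 then G else H) by case: ifP.
by apply: computable_ext (computable_comp cf cGH) => v; rewrite /thead !tnth_mktuple.
Qed.

Lemma computable_succ k (G : k.-tuple nat -> nat) :
  computable G -> computable (fun v => (G v).+1).
Proof. by apply: computable_comp1; exists RSucc. Qed.

Lemma computable_const k c : computable (fun _ : k.-tuple nat => c).
Proof.
elim: c => [|c IHc]; first by exists (RZero k).
exact: computable_succ.
Qed.

Lemma computable_prec k (f : k.-tuple nat -> nat) (g : k.+2.-tuple nat -> nat)
    (F : nat -> k.-tuple nat -> nat) :
  computable f -> computable g -> (forall v, F 0 v = f v) ->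
  (forall i v, F i.+1 v = g [tuple of i :: F i v :: v]) ->
  computable (fun v : k.+1.-tuple nat => F (thead v) [tuple of behead v]).
Proof.
move=> [p cp] [q cq] F0 FS; exists (RPrec p q) => v /=.
exists (fun i => F i [tuple of behead v]); split=> // [|i _].
  by rewrite F0; apply: cp.
by rewrite FS; apply: cq.
Qed.

Lemma computable_rec k (f : k.-tuple nat -> nat) (g : k.+2.-tuple nat -> nat)
    (F : nat -> k.-tuple nat -> nat) (b : k.-tuple nat -> nat) :
  computable f -> computable g -> computable b -> (forall v, F 0 v = f v) ->
  (forall i v, F i.+1 v = g [tuple of i :: F i v :: v]) ->
  computable (fun v => F (b v) v).
Proof.
move=> cf cg cb F0 FS.
pose G (i : 'I_k.+1) (v : k.-tuple nat) :=
  if unlift ord0 i is Some j then tnth v j else b v.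
have cG i : computable (G i).
  by rewrite /G; case: (unlift _ _) => [j|] //; apply: computable_proj.
apply: computable_ext (computable_comp (computable_prec cf cg F0 FS) cG) => v.
rewrite /thead tnth_mktuple /G unlift_none; congr (F _ _).
apply: eq_from_tnth => i; rewrite tnth_behead tnth_mktuple.
rewrite (_ : inord i.+1 = lift ord0 i) ?liftK //.
by apply: val_inj; rewrite /= inordK // ltnS.
Qed.

(** Addition, multiplication, powers and subtraction are all obtained by
    iterating a binary function with one argument fixed. *)
Lemma computable_iter k (h : nat -> nat -> nat) (f b H : k.-tuple nat -> nat) :
  computable (fun v : 2.-tuple nat => h (thead v) (tnth v (lift ord0 ord0))) ->
  computable f -> computable H -> computable b ->
  computable (fun v => iter (b v) (h (H v)) (f v)).
Proof.
move=> ch cf cH cb.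
pose H' (w : k.+2.-tuple nat) := H [tuple of behead [tuple of behead w]].
have cH' : computable H'.
  pose G (i : 'I_k) (w : k.+2.-tuple nat) := tnth w (lift ord0 (lift ord0 i)).
  have cG i : computable (G i) by apply: computable_proj.
  apply: computable_ext (computable_comp cH cG) => w; congr H.
  apply: eq_from_tnth => i; rewrite tnth_mktuple !tnth_behead /G.
  by congr tnth; apply: val_inj; rewrite /= !inordK // !ltnS.
pose g (w : k.+2.-tuple nat) := h (H' w) (tnth w (lift ord0 ord0)).
have cg : computable g.
  by apply: computable_comp2 => //; apply: computable_proj.
pose F i v := iter i (h (H v)) (f v).
apply: (@computable_rec _ f g F) => // i v; rewrite /F /= /g /H'.
congr h; congr H; exact: val_inj.
Qed.

Lemma computable_add k (F G : k.-tuple nat -> nat) :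
  computable F -> computable G -> computable (fun v => F v + G v).
Proof.
move=> cF cG; pose h (_ a : nat) := a.+1.
have := @computable_iter k h F G F; rewrite /h => /(_ _ cF cF cG) H.
apply: computable_ext (H _) => [v|]; last first.
  by apply: computable_succ; apply: computable_proj.
by rewrite iter_succn.
Qed.

Lemma computable_mul k (F G : k.-tuple nat -> nat) :
  computable F -> computable G -> computable (fun v => F v * G v).
Proof.
move=> cF cG.
have := @computable_iter k addn (fun=> 0) G F.
move=> /(_ _ (computable_const _ 0) cF cG) H.
apply: computable_ext (H _) => [v|]; last first.
  by apply: computable_add; apply: computable_proj.
by rewrite iter_addn_0.
Qed.

Lemma computable_exp2 k (F : k.-tuple nat -> nat) :
  computable F -> computable (fun v => 2 ^ F v).
Proof.
move=> cF; have c := computable_const k.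
have := @computable_iter k muln (fun=> 1) F (fun=> 2).
move=> /(_ _ (c 1) (c 2) cF) H.
apply: computable_ext (H _) => [v|]; last first.
  by apply: computable_mul; apply: computable_proj.
by rewrite iter_muln_1.
Qed.

Lemma computable_pred k (F : k.-tuple nat -> nat) :
  computable F -> computable (fun v => (F v).-1).
Proof.
move=> cF; have c := computable_const k.
apply: (@computable_rec k (fun=> 0) (fun w => thead w) (fun i _ => i.-1)) => //.
exact: computable_proj.
Qed.

Lemma computable_sub k (F G : k.-tuple nat -> nat) :
  computable F -> computable G -> computable (fun v => F v - G v).
Proof.
move=> cF cG; pose h (_ a : nat) := a.-1.
have := @computable_iter k h F G F; rewrite /h => /(_ _ cF cF cG) H.
apply: computable_ext (H _) => [v|]; last first.
  by apply: computable_pred; apply: computable_proj.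
by elim: (G v) => [|i IHi] /=; [rewrite subn0|rewrite IHi subnS].
Qed.

Lemma computable_gt0 k (F : k.-tuple nat -> nat) :
  computable F -> computable (fun v => nat_of_bool (0 < F v)).
Proof.
move=> cF; have c := computable_const k.
have c1 := computable_sub (c 1) (computable_sub (c 1) cF).
by apply: computable_ext c1 => v; case: (F v).
Qed.

(** A syntax for formulas of bounded arithmetic, with de Bruijn variables.  In
    [Ex b a] the bound b is outside the scope of the new variable.  Truth values
    are numbers, positive for true. *)
Inductive expr : Type :=
| Var of nat
| Cst of nat
| Add of expr & expr
| Mul of expr & expr
| Exp2 of expr
| Lt of expr & expr
| Ex of expr & expr.

Fixpoint eval (env : seq nat) (e : expr) : nat :=
  match e with
  | Var i => nth 0 env i
  | Cst c => c
  | Add a b => eval env a + eval env b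
  | Mul a b => eval env a * eval env b
  | Exp2 a => 2 ^ eval env a
  | Lt a b => eval env a < eval env b
  | Ex b a => has (fun i => 0 < eval (i :: env) a) (iota 0 (eval env b))
  end.

(** A bounded quantifier is a recursion on the bound that keeps the truth value
    of the disjunction found so far. *)
Lemma computable_eval k (e : expr) : computable (fun v : k.-tuple nat => eval v e).
Proof.
elim: e k => /= [i|c|a IHa b IHb|a IHa b IHb|a IHa|a IHa b IHb|b IHb a IHa] k.
- have [lt|ge] := ltnP i k; last first.
    apply: computable_ext (computable_const k 0) => v.
    by rewrite nth_default // size_tuple.
  apply: computable_ext (computable_proj (Ordinal lt)) => v.
  by rewrite (tnth_nth 0).
- exact: computable_const.
- exact: computable_add.
- exact: computable_mul.
- exact: computable_exp2.
- apply: computable_ext (computable_gt0 (computable_sub (IHb k) (IHa k))) => v.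
  by rewrite subn_gt0.
- pose g (w : k.+2.-tuple nat) :=
    (0 < tnth w (lift ord0 ord0) + eval (thead w :: behead (behead w)) a : nat).
  pose F i (v : k.-tuple nat) : nat :=
    has (fun i => 0 < eval (i :: v) a) (iota 0 i).
  apply: (@computable_rec k (fun=> 0) g F) => //; first exact: computable_const.
    apply/computable_gt0/computable_add; first exact: computable_proj.
    pose G (i : 'I_k.+1) (w : k.+2.-tuple nat) :=
      if unlift ord0 i is Some j then tnth w (lift ord0 (lift ord0 j)) else thead w.
    have cG i : computable (G i).
      by rewrite /G; case: (unlift _ _) => [j|] //; apply: computable_proj.
    apply: computable_ext (computable_comp (IHa k.+1) cG) => w.
    congr eval; apply: (@eq_from_nth _ 0) => [|i].
      by rewrite size_tuple /= !size_behead size_tuple.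
    rewrite size_tuple => lt; rewrite -(tnth_nth 0 _ (Ordinal lt)) tnth_mktuple /G.
    case: unliftP => [j|] /(congr1 val) /= -> //.
    by rewrite /= !nth_behead (tnth_nth 0).
  by move=> i v; rewrite /F /g -(addn1 i) iotaD has_cat /= orbF addn_gt0 lt0b.
Qed.

(** * Deciding reachability under bounded rewriting *)

Definition holds (env : seq nat) (e : expr) : bool := 0 < eval env e.
Definition fNot (a : expr) : expr := Lt a (Cst 1).
Definition fAnd (a b : expr) : expr := Mul a b.
Definition fOr (a b : expr) : expr := Add a b.
Definition fEq (a b : expr) : expr := fAnd (fNot (Lt a b)) (fNot (Lt b a)).

Lemma holds_Lt env a b : holds env (Lt a b) = (eval env a < eval env b).
Proof. by rewrite /holds /= lt0b. Qed.
Lemma holds_fNot env a : holds env (fNot a) = ~~ holds env a.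
Proof. by rewrite holds_Lt /holds ltnS leqn0 lt0n negbK. Qed.
Lemma holds_fAnd env a b : holds env (fAnd a b) = holds env a && holds env b.
Proof. by rewrite /holds /= muln_gt0. Qed.
Lemma holds_fOr env a b : holds env (fOr a b) = holds env a || holds env b.
Proof. by rewrite /holds /= addn_gt0. Qed.
Lemma holds_fEq env a b : holds env (fEq a b) = (eval env a == eval env b).
Proof. by rewrite holds_fAnd !holds_fNot !holds_Lt -!leqNgt eqn_leq andbC. Qed.
Lemma holds_Ex env b a :
  reflect (exists2 i, i < eval env b & holds (i :: env) a) (holds env (Ex b a)).
Proof.
rewrite /holds /= lt0b; apply: (iffP hasP) => -[i];
  by rewrite ?mem_iota => lt h; exists i => //; rewrite mem_iota.
Qed.
Definition holdsE := (holds_fNot, holds_fAnd, holds_fOr, holds_fEq, holds_Lt).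

Definition bit (i c : nat) : bool := odd (c %/ 2 ^ i).

(** The digit is read off c = a + 2^i (2 b + 1) with a < 2^i. *)
Definition fBit (i c : nat) : expr :=
  Ex (Exp2 (Var i)) (Ex (Add (Var c.+1) (Cst 1))
    (fEq (Var c.+2) (Add (Var 1)
       (Mul (Exp2 (Var i.+2)) (Add (Mul (Cst 2) (Var 0)) (Cst 1)))))).

Lemma holds_fBit env i c : holds env (fBit i c) = bit (nth 0 env i) (nth 0 env c).
Proof.
rewrite /fBit /bit; set m := nth 0 env i; set d := nth 0 env c.
have m0 : 0 < 2 ^ m by rewrite expn_gt0.
apply/holds_Ex/idP => [[a lt /holds_Ex[b _]]|od].
  rewrite holdsE /= -/d -/m => /eqP ->; move: lt; rewrite /= -/m => lt.
  by rewrite addnC mulnC divnMDl // (divn_small lt) addn0 mul2n addn1 /= odd_double.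
exists (d %% 2 ^ m); first by rewrite /= ltn_pmod.
apply/holds_Ex; exists (d %/ 2 ^ m)./2.
  rewrite /= addn1 ltnS -/d; apply: leq_trans (leq_div d (2 ^ m)).
  by rewrite -[leqRHS]odd_double_half -addnn addnA leq_addl.
rewrite holdsE /= -/m -/d {1}(divn_eq d (2 ^ m)) addnC mulnC; apply/eqP.
by rewrite -{1}(odd_double_half (d %/ 2 ^ m)) od mul2n addn1.
Qed.

Lemma bit_mask (f : nat -> bool) N :
  exists2 c, c < 2 ^ N & forall i, i < N -> bit i c = f i.
Proof.
elim: N => [|N [c lt IH]]; first by exists 0.
exists (c + f N * 2 ^ N) => [|i].
  by rewrite expnS mul2n -addnn -addSn leq_add // -{2}[2 ^ N]mul1n leq_mul // leq_b1.
rewrite ltnS leq_eqVlt /bit => /orP[/eqP->|iN].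
  by rewrite addnC divnMDl ?expn_gt0 // (divn_small lt) addn0 oddb.
have -> : f N * 2 ^ N = (f N * 2 ^ (N - i.+1)).*2 * 2 ^ i.
  have -> : 2 ^ N = 2 ^ (N - i.+1) * 2 * 2 ^ i.
    by rewrite -mulnA -expnS -expnD subnK.
  by rewrite -muln2 !mulnA.
by rewrite addnC divnMDl ?expn_gt0 // oddD odd_double /= -/(bit i c) IH.
Qed.

Import CodeSeq.

(** The code of n1, ..., nk is, in binary, a 1 followed by nk zeros, and so on down
    to a 1 followed by n1 zeros; this is the number of its binary digits. *)
Definition code_length (s : seq nat) : nat := sumn (map succn s).

(** In binary, concatenating words juxtaposes their codes, which makes rewriting
    expressible by arithmetic. *)
Lemma code_cat u v : code (u ++ v) = code u + 2 ^ code_length u * code v.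
Proof.
elim: u => [|n u IHu] /=; first by rewrite add0n mul1n.
rewrite /= in IHu *; rewrite IHu /code_length /= expnD expnS.
by rewrite -!mul2n; move: (2 ^ n) (2 ^ _); nia.
Qed.

(** The inequality 2^e < 2 p + 2 excludes leading zeros, and covers p = e = 0. *)
Definition is_length (p e : nat) : bool := (p < 2 ^ e) && (2 ^ e < 2 * p + 2).

Lemma code_lengthP s : is_length (code s) (code_length s).
Proof.
elim: s => //= n s; rewrite /is_length /code_length /= expnD expnS -!mul2n.
have : 0 < 2 ^ n by rewrite expn_gt0.
by move: (2 ^ n) (2 ^ _) => a b; nia.
Qed.

Lemma is_length_inj p e e' : is_length p e -> is_length p e' -> e = e'.
Proof.
wlog lt : e e' / e < e' => [H h h'|].
  by case: (ltngtP e e') => // lt; [apply: H|apply/esym/H].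
rewrite /is_length -(subnKC lt) expnD expnS => /andP[h1 _] /andP[_ h2].
have : 0 < 2 ^ (e' - e.+1) by rewrite expn_gt0.
by move: h1 h2; move: (2 ^ e) (2 ^ _); nia.
Qed.

Lemma is_length_ltn p e : is_length p e -> e < 2 * p + 2.
Proof. by move=> /andP[_]; apply: ltn_trans; apply: ltn_expl. Qed.

Lemma size_code s : size s <= code s.
Proof.
elim: s => //= n s IHs; apply: leq_trans (_ : (code s).*2.+1 <= _).
  by rewrite ltnS -addnn (leq_trans IHs) // leq_addr.
by rewrite -{1}[_.+1]mul1n leq_mul // expn_gt0.
Qed.

Lemma code_length_bound K s : all (fun i => i < K) s -> code_length s <= K * size s.
Proof.
elim: s => [|i s IHs] //= /andP[lt /IHs]; rewrite /code_length /= mulnS.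
exact: leq_add.
Qed.

Section Search.

Variables (T : eqType) (f : T -> nat) (K : nat).
Hypotheses (f_inj : injective f) (f_lt : forall t, f t < K).
Variables (R : seq (seq T * seq T)) (LW RW : seq (seq T)).

(** Rewriting may happen anywhere, whereas left and right moves add a word at one
    end.  Rules and moves are also followed backwards, through [conn_sym]. *)
Inductive step : seq T -> seq T -> Prop :=
| step_rule X Y p q : (X, Y) \in R -> step (p ++ X ++ q) (p ++ Y ++ q)
| step_left z u : z \in LW -> step u (z ++ u)
| step_right z u : z \in RW -> step u (u ++ z).

Inductive conn (L : nat) : seq T -> seq T -> Prop :=
| conn_refl u : conn L u u
| conn_sym u v : conn L u v -> conn L v u
| conn_trans u v w : conn L u v -> conn L v w -> conn L u w
| conn_step u v : size u <= L -> size v <= L -> step u v -> conn L u v.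

Let cd (w : seq T) : nat := code (map f w).
Let bl (w : seq T) : nat := code_length (map f w).

Let cd_inj : injective cd.
Proof. by move=> u v /(can_inj codeK) /(inj_map f_inj). Qed.

Let cd_cat u v : cd (u ++ v) = cd u + 2 ^ bl u * cd v.
Proof. by rewrite /cd map_cat code_cat. Qed.

Definition fLength (p e : nat) : expr :=
  fAnd (Lt (Var p) (Exp2 (Var e)))
      (Lt (Exp2 (Var e)) (Add (Mul (Cst 2) (Var p)) (Cst 2))).

(** Under the three quantifiers, variables 0, 1, 2 are the codes of the unchanged
    suffix and prefix and the number of digits of the prefix. *)
Definition fRule (i j : nat) (XY : seq T * seq T) : expr :=
  Ex (Add (Mul (Cst 2) (Var i)) (Cst 2))
  (Ex (Add (Var i.+1) (Cst 1))
  (Ex (Add (Var i.+2) (Cst 1))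
  (fAnd (fLength 1 2) (fAnd
   (fEq (Var i.+3) (Add (Var 1) (Mul (Exp2 (Var 2))
     (Add (Cst (cd XY.1)) (Mul (Cst (2 ^ bl XY.1)) (Var 0))))))
   (fEq (Var j.+3) (Add (Var 1) (Mul (Exp2 (Var 2))
     (Add (Cst (cd XY.2)) (Mul (Cst (2 ^ bl XY.2)) (Var 0)))))))))).

Definition fLeft (i j : nat) (z : seq T) : expr :=
  fEq (Var j) (Add (Cst (cd z)) (Mul (Cst (2 ^ bl z)) (Var i))).

Definition fRight (i j : nat) (z : seq T) : expr :=
  Ex (Add (Mul (Cst 2) (Var i)) (Cst 2))
  (fAnd (fLength i.+1 0)
       (fEq (Var j.+1) (Add (Var i.+1) (Mul (Exp2 (Var 0)) (Cst (cd z)))))).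

Definition fAny (es : seq expr) : expr := foldr fOr (Cst 0) es.

Lemma holds_fAny env es : holds env (fAny es) = has (holds env) es.
Proof. by elim: es => //= e es <-; rewrite holds_fOr. Qed.

Definition fStep (i j : nat) : expr :=
  fOr (fAny (map (fRule i j) R))
     (fOr (fAny (map (fLeft i j) LW)) (fAny (map (fRight i j) RW))).

(** The relation on codes that the formula expresses: p, q and u range over all
    lists of numbers, including those that are not codes of words over T. *)
Inductive nstep : nat -> nat -> Prop :=
| nstep_rule X Y p q : (X, Y) \in R ->
    nstep (code (p ++ map f X ++ q)) (code (p ++ map f Y ++ q))
| nstep_left z u : z \in LW -> nstep (code u) (code (map f z ++ u))
| nstep_right z u : z \in RW -> nstep (code u) (code (u ++ map f z)).

Lemma holds_fLength env p e :
  holds env (fLength p e) = is_length (nth 0 env p) (nth 0 env e).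
Proof. by rewrite /fLength holdsE !holdsE. Qed.

Lemma holds_fStep env i j :
  reflect (nstep (nth 0 env i) (nth 0 env j)) (holds env (fStep i j)).
Proof.
rewrite /fStep !holds_fOr !holds_fAny !has_map; apply: (iffP or3P).
- case=> /hasP[z zin] /=.
  + case: z zin => X Y XYR.
    move=> /holds_Ex[e _ /holds_Ex[p _ /holds_Ex[q _]]].
    rewrite holds_fAnd holds_fLength holds_fAnd !holds_fEq /= => /and3P[pe /eqP-> /eqP->].
    have := nstep_rule (decode p) (decode q) XYR.
    rewrite !code_cat !decodeK (_ : code_length (decode p) = e) //.
    by apply: is_length_inj pe; rewrite -{1}[p]decodeK code_lengthP.
  + rewrite holds_fEq /= => /eqP->.
    by have := nstep_left (decode (nth 0 env i)) zin; rewrite code_cat decodeK.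
  + move=> /holds_Ex[e _]; rewrite holds_fAnd holds_fLength holds_fEq /= => /andP[ue /eqP->].
    have := nstep_right (decode (nth 0 env i)) zin.
    rewrite code_cat decodeK (_ : code_length _ = e) //.
    by apply: is_length_inj ue; rewrite -{1}[nth 0 env i]decodeK code_lengthP.
- set a := nth 0 env i; set b := nth 0 env j => st.
  case: {-1}_ {-1}_ / st (erefl a) (erefl b) => [X Y p q XYR|z u zA|z u zB] ea eb.
  + constructor 1; apply/hasP; exists (X, Y) => //=.
    have := code_lengthP p; set e := code_length p => pe.
    have leq2 k : 0 < 2 ^ k by rewrite expn_gt0.
    have pa : code p <= a by rewrite ea code_cat leq_addr.
    have qa : code q <= a.
      rewrite ea !code_cat; apply: leq_trans (leq_addl _ _).
      apply: leq_trans (leq_pmull _ (leq2 e)); apply: leq_trans (leq_addl _ _).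
      exact: leq_pmull.
    apply/holds_Ex; exists e; first by have := is_length_ltn pe; rewrite /= -/a; lia.
    apply/holds_Ex; exists (code p); first by rewrite /= -/a; lia.
    apply/holds_Ex; exists (code q); first by rewrite /= -/a; lia.
    rewrite holds_fAnd holds_fLength holds_fAnd !holds_fEq /= pe -/a -/b ea eb !code_cat.
    by rewrite !eqxx.
  + constructor 2; apply/hasP; exists z => //=.
    by rewrite holds_fEq /= -/a -/b ea eb code_cat.
  + constructor 3; apply/hasP; exists z => //=.
    have := code_lengthP u; set e := code_length u => ue.
    apply/holds_Ex; exists e; first by rewrite /= -/a ea; apply: is_length_ltn.
    by rewrite holds_fAnd holds_fLength holds_fEq /= -/a -/b ea eb ue code_cat eqxx.
Qed.

Inductive nconn (N : nat) : nat -> nat -> Prop :=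
| nconn_refl u : nconn N u u
| nconn_sym u v : nconn N u v -> nconn N v u
| nconn_trans u v w : nconn N u v -> nconn N v w -> nconn N u w
| nconn_step u v : u < N -> v < N -> nstep u v -> nconn N u v.

(** The bound is spelled out from the two input variables, whose indices change
    under quantifiers. *)
Definition fBound (M i j : nat) : expr :=
  Exp2 (Mul (Cst M) (Add (Add (Var i) (Var j)) (Cst 1))).

(** There is no set c, below 2^N, that contains the first input, does not contain the
    second one, and never separates the two ends u, v of a step below N.  In the
    innermost scope the variables are v, u, c and the inputs, in that order. *)
Definition fConnected (M : nat) : expr :=
  fNot (Ex (Exp2 (fBound M 0 1))
    (fAnd (fAnd (fBit 1 0) (fNot (fBit 2 0)))
    (fNot (Ex (fBound M 1 2) (Ex (fBound M 2 3)
       (fAnd (fStep 1 0) (fOr (fAnd (fBit 1 2) (fNot (fBit 0 2)))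
                           (fAnd (fBit 0 2) (fNot (fBit 1 2)))))))))).

Lemma holds_fConnected M x y :
  let N := 2 ^ (M * (x + y + 1)) in x < N -> y < N ->
  reflect (nconn N x y) (holds [:: x; y] (fConnected M)).
Proof.
move=> N xN yN; rewrite /fConnected holds_fNot; apply: (iffP negP).
- move=> H; apply: contrapT => nxy; apply: H.
  (* the component of x would be such a separating set *)
  have [c lt cP] := bit_mask (fun z => `[< nconn N x z >]) N.
  apply/holds_Ex; exists c => //.
  rewrite !holdsE !holds_fBit /= !cP //; apply/andP; split.
    by apply/andP; split; [apply/asboolP; constructor|apply/asboolPn].
  apply/negP => /holds_Ex[u /= uN /holds_Ex[v /= vN]].
  rewrite holds_fAnd => /andP[/holds_fStep /= uv].
  rewrite !holdsE !holds_fBit /= !cP //.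
  have cuv : nconn N u v by constructor 4.
  case/orP=> /andP[/asboolP h /asboolPn]; apply.
    exact: nconn_trans h cuv.
  exact: nconn_trans h (nconn_sym cuv).
- move=> xy /holds_Ex[c _].
  rewrite !holdsE !holds_fBit /= -andbA => /and3P[xc /negP yc /negP cl]; apply: yc.
  suff {xc} E u v : nconn N u v -> bit u c = bit v c by rewrite -(E _ _ xy).
  elim=> // {xy xN yN} {}u {}v => [w _ -> _ -> //|uN vN uv].
  apply/eqP; apply: contraT => ne; case: cl.
  apply/holds_Ex; exists u => //; apply/holds_Ex; exists v => //.
  rewrite holds_fAnd; apply/andP; split; first exact/holds_fStep.
  rewrite !holdsE !holds_fBit /=.
  by move: ne; case: (bit u c); case: (bit v c).
Qed.

Lemma map_cat_inv (w : seq T) (u v : seq nat) : map f w = u ++ v ->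
  exists w1 w2, [/\ w = w1 ++ w2, u = map f w1 & v = map f w2].
Proof.
move=> e; exists (take (size u) w), (drop (size u) w).
by rewrite cat_take_drop map_take map_drop e take_size_cat ?drop_size_cat.
Qed.

Variable rel : seq T -> seq T -> Prop.
Hypotheses (rel_refl : forall u, rel u u)
  (rel_sym : forall u v, rel u v -> rel v u)
  (rel_trans : forall u v w, rel u v -> rel v w -> rel u w)
  (rel_step : forall u v, step u v -> rel u v).

(** Connectedness of codes is compared with rel in both directions, because a
    path between two codes of words must be shown to stay among codes of words,
    whichever way its steps are followed. *)
Let related (x y : nat) : Prop :=
  (forall u, x = cd u -> exists2 v, y = cd v & rel u v) /\
  (forall v, y = cd v -> exists2 u, x = cd u & rel u v).

Let related_nstep x y : nstep x y -> related x y.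
Proof.
case=> [X Y p q XYR|z u zA|z u zB]; split=> w /(can_inj codeK) /esym.
- move=> /map_cat_inv[w1 [w' [-> -> /esym/map_cat_inv[w2 [w3 [-> /(inj_map f_inj) <- ->]]]]]].
  exists (w1 ++ Y ++ w3); first by rewrite /cd !map_cat.
  by apply: rel_step; constructor.
- move=> /map_cat_inv[w1 [w' [-> -> /esym/map_cat_inv[w2 [w3 [-> /(inj_map f_inj) <- ->]]]]]].
  exists (w1 ++ X ++ w3); first by rewrite /cd !map_cat.
  by apply: rel_step; constructor.
- move=> <-; exists (z ++ w); first by rewrite /cd map_cat.
  by apply: rel_step; constructor.
- move=> /map_cat_inv[w1 [w2 [-> /(inj_map f_inj) <- ->]]].
  by exists w2 => //; apply: rel_step; constructor.
- move=> <-; exists (w ++ z); first by rewrite /cd map_cat.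
  by apply: rel_step; constructor.
- move=> /map_cat_inv[w1 [w2 [-> -> /(inj_map f_inj) <-]]].
  by exists w1 => //; apply: rel_step; constructor.
Qed.

Let related_nconn N x y : nconn N x y -> related x y.
Proof.
elim=> {x y} [x|x y _ [xy yx]|x y z _ [xy yx] _ [yz zy]|x y _ _].
- by split=> u ->; exists u.
- by split=> u => [/yx|/xy] [v -> /rel_sym]; exists v.
- split=> u => [/xy[v /yz[w -> vw] uv]|/zy[v /yx[w -> wv] vu]]; exists w => //.
    exact: rel_trans uv vw.
  exact: rel_trans wv vu.
- exact: related_nstep.
Qed.

(** An equivalence relation that contains the steps, and whose classes are connected
    through words of length linear in those of the endpoints, is decidable: the
    linear bound on lengths becomes an explicit bound on codes, within which
    [fConnected] decides connectedness. *)
Lemma decide_connected C :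
  (forall u v, rel u v -> conn (C * (size u + size v + 1)) u v) ->
  exists p : recfun 2, forall u v : seq T,
    (rel u v -> computes p [tuple cd u; cd v] 1) /\
    (~ rel u v -> computes p [tuple cd u; cd v] 0).
Proof.
move=> complete; pose M := K * C.+1.
have [p cp] := computable_eval 2 (fConnected M).
exists p => u v; have := cp [tuple cd u; cd v] => /=.
set b := (X in computes _ _ X).
have cd_bound L w : size w <= L -> cd w < 2 ^ (K * L).
  move=> wL; have /andP[lt _] := code_lengthP (map f w); apply: leq_trans lt _.
  rewrite leq_exp2l //; apply: leq_trans (@code_length_bound K _ _) _; last first.
    by rewrite size_map leq_mul.
  by apply/allP => _ /mapP[t _ ->]; apply: f_lt.
have size_cd w : size w <= cd w by rewrite -(size_map f); apply: size_code.
set N := 2 ^ (M * (cd u + cd v + 1)).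
have uN : cd u < N.
  apply: leq_trans (cd_bound _ _ (size_cd u)) _.
  rewrite leq_exp2l // /M -mulnA leq_mul //.
  by apply: leq_trans (leq_pmull _ (ltn0Sn C)); lia.
have vN : cd v < N.
  apply: leq_trans (cd_bound _ _ (size_cd v)) _.
  rewrite leq_exp2l // /M -mulnA leq_mul //.
  by apply: leq_trans (leq_pmull _ (ltn0Sn C)); lia.
have nc L x y : K * L <= M * (cd u + cd v + 1) -> conn L x y -> nconn N (cd x) (cd y).
  move=> LN; elim=> {x y} [x|x y _ xy|x y z _ xy _ yz|x y xL yL xy].
  - by constructor.
  - by constructor.
  - exact: nconn_trans xy yz.
  - constructor 4.
    + by apply: leq_trans (cd_bound _ _ xL) _; rewrite leq_exp2l.
    + by apply: leq_trans (cd_bound _ _ yL) _; rewrite leq_exp2l.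
    + by rewrite /cd; case: xy => *; rewrite !map_cat; constructor.
have bE : rel u v <-> b = 1.
  rewrite /b; have -> : (eval [:: cd u; cd v] (fConnected M) = 1) <->
      holds [:: cd u; cd v] (fConnected M).
    by rewrite /holds /fConnected /fNot /=; case: (_ < 1).
  split=> [uv|/(holds_fConnected uN vN)/related_nconn [+ _]].
    apply/holds_fConnected => //; apply: nc (complete _ _ uv).
    have su := size_cd u; have sv := size_cd v.
    by rewrite /M -mulnA leq_mul //; apply: leq_mul; lia.
  by move=> /(_ _ erefl) [w /cd_inj <-].
have b01 : b = 0 \/ b = 1.
  by rewrite /b /fConnected /fNot /=; case: (_ < 1); [right|left].
move=> cb; split=> [/bE b1|nuv]; first by rewrite b1 in cb.
by case: b01 => [b0|/bE //]; rewrite b0 in cb.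
Qed.

End Search.

(** * The monoid of positive braids embeds in the braid group *)

Section Positive.
Variable n : nat.

Definition in_range (i : nat) : bool := i < n.-1.

Definition to_word (u : seq nat) : word n := [seq (i, true) | i <- pmap insub u].

Definition braid_rules : seq (word n * word n) :=
  [seq ([:: (i, true); (j, true)], [:: (j, true); (i, true)])
     | i : 'I_n.-1 <- enum 'I_n.-1,
       j : 'I_n.-1 <- [seq j : 'I_n.-1 <- enum 'I_n.-1 | far i j]] ++
  [seq ([:: (i, true); (j, true); (i, true)], [:: (j, true); (i, true); (j, true)])
     | i : 'I_n.-1 <- enum 'I_n.-1,
       j : 'I_n.-1 <- [seq j : 'I_n.-1 <- enum 'I_n.-1 | adj i j]].

Lemma to_word_cat u v : to_word (u ++ v) = to_word u ++ to_word v.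
Proof. by rewrite /to_word pmap_cat map_cat. Qed.

Lemma to_word_cons i u (lt : i < n.-1) : to_word (i :: u) = (Ordinal lt, true) :: to_word u.
Proof. by rewrite /to_word /= insubT. Qed.

Lemma to_word_ord (i : 'I_n.-1) u : to_word (val i :: u) = (i, true) :: to_word u.
Proof.
by rewrite (to_word_cons _ (ltn_ord i)) (_ : Ordinal _ = i) //; apply: val_inj.
Qed.

Lemma size_to_word u : size (to_word u) <= size u.
Proof. by rewrite size_map size_pmap count_size. Qed.

Lemma braid_rules_sound X Y : (X, Y) \in braid_rules -> braid_eq X Y.
Proof.
rewrite mem_cat => /orP[] /allpairsPdep[i [j [_]]]; rewrite mem_filter => /andP[ij _] [-> ->].
  by case/orP: ij => lt; [|apply: braid_eq_sym]; exact: braid_eq_far.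
by case/orP: ij => /eqP e; [apply: braid_eq_sym|]; exact: braid_eq_braid.
Qed.

(** Stated for an arbitrary relation E, since it serves both for equality in the
    braid group and for connectedness through short words. *)
Lemma to_word_peq (E : word n -> word n -> Prop) :
  (forall u, E u u) -> (forall u v w, E u v -> E v w -> E u w) ->
  (forall X Y p, (X, Y) \in braid_rules -> forall q, E (p ++ X ++ q) (p ++ Y ++ q)) ->
  forall u v, all in_range u -> u =+ v -> E (to_word u) (to_word v).
Proof.
move=> Er Et Es u v Su uv.
suff [_] : all in_range u = all in_range v /\
  (all in_range u -> E (to_word u) (to_word v)) by apply.
elim/peq_elim: u v / uv {Su} => [//|u v w [-> uv] [<- vw]|u v st]; first by eauto.
split=> [|Su]; first exact/peq_all/peq_step.
rewrite -[to_word u]/([::] ++ to_word u) -[to_word v]/([::] ++ to_word v).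
elim: st {Su}[::] Su => [i j w ij|i j w ij|i {}u {}v _ IH] p /=.
- move=> /and3P[iS jS _]; rewrite !to_word_cons.
  apply: (Es [:: _; _] [:: _; _]); rewrite mem_cat; apply/orP; left.
  apply/allpairsPdep; exists (Ordinal iS), (Ordinal jS).
  by rewrite mem_enum mem_filter mem_enum ij.
- move=> /and4P[iS jS _ _]; rewrite !to_word_cons.
  apply: (Es [:: _; _; _] [:: _; _; _]); rewrite mem_cat; apply/orP; right.
  apply/allpairsPdep; exists (Ordinal iS), (Ordinal jS).
  by rewrite mem_enum mem_filter mem_enum ij.
- move=> /andP[iS Su]; rewrite !to_word_cons -cat_rcons -[X in E _ X]cat_rcons.
  exact: IH.
Qed.

Lemma braid_eq_catl (u v w : word n) : braid_eq u v -> braid_eq (w ++ u) (w ++ v).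
Proof. by apply: braid_eq_cat; apply: braid_eq_refl. Qed.

Lemma braid_eq_catr (u v w : word n) : braid_eq u v -> braid_eq (u ++ w) (v ++ w).
Proof. by move=> uv; apply: braid_eq_cat uv (braid_eq_refl _). Qed.

Lemma braid_eq_to_word u v : all in_range u -> u =+ v -> braid_eq (to_word u) (to_word v).
Proof.
apply: to_word_peq; [exact: braid_eq_refl|exact: braid_eq_trans|].
by move=> X Y p /braid_rules_sound XY q; apply/braid_eq_catl/braid_eq_catr.
Qed.

Definition twist : seq nat := full_twist in_range n.-1.
Notation N := twist.

Lemma twist_in_range : all in_range N.
Proof. by apply: sub_all (full_twist_all _ _) => i /andP[]. Qed.

Lemma twist_central i : in_range i -> commutes [:: i] N.
Proof. by move=> lt; apply: full_twist_central. Qed.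

Lemma twist_ldiv i : in_range i -> ldiv [:: i] N.
Proof. by move=> lt; apply: full_twist_ldiv. Qed.

Notation pow := (pow_word N).

Lemma twist_quotient_exists (i : nat) :
  exists r, in_range i -> i :: r =+ N.
Proof.
have [/twist_ldiv[r ir]|] := boolP (in_range i); last by exists [::].
by exists r.
Qed.

Definition twist_quotient (i : nat) : seq nat := projT1 (cid (twist_quotient_exists i)).

Lemma cons_twist_quotient i : in_range i -> i :: twist_quotient i =+ N.
Proof. by rewrite /twist_quotient; case: cid. Qed.

Lemma twist_quotient_cat i : in_range i -> twist_quotient i ++ [:: i] =+ N.
Proof.
move=> Si; apply: (@peq_consI i); rewrite -[X in _ =+ X]/([:: i] ++ N).
by rewrite -cat_cons cons_twist_quotient // twist_central.
Qed.

Lemma twist_quotient_in_range i : in_range i -> all in_range (twist_quotient i).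
Proof.
move=> Si; have := twist_in_range.
by rewrite -(peq_all _ (cons_twist_quotient Si)) => /andP[].
Qed.

Definition num_letter (l : letter n) : seq nat :=
  if l.2 then [:: val l.1] else twist_quotient l.1.

(** A word with negative letters is a fraction with denominator a power of N: the
    inverse of the letter i is the cofactor of i in N, divided by N. *)
Definition numerator (w : word n) : seq nat := flatten (map num_letter w).
Definition negatives (w : word n) : nat := count (fun l => ~~ l.2) w.

Lemma numerator_cat u v : numerator (u ++ v) = numerator u ++ numerator v.
Proof. by rewrite /numerator map_cat flatten_cat. Qed.

Lemma negatives_cat u v : negatives (u ++ v) = negatives u + negatives v.
Proof. exact: count_cat. Qed.

Lemma ord_in_range (i : 'I_n.-1) : in_range i. Proof. exact: ltn_ord. Qed.

Lemma numerator_in_range w : all in_range (numerator w).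
Proof.
elim: w => //= l w IHw; rewrite all_cat IHw andbT /num_letter.
by case: l.2; rewrite /= ?ord_in_range // twist_quotient_in_range // ord_in_range.
Qed.

Lemma pow_commutes u k : all in_range u -> commutes u (pow k).
Proof. exact: pow_word_commutes twist_central _ _. Qed.

(** Equality in the group implies equality of fractions after crossing the
    denominators.  This maps the braid group to the localization of the
    positive monoid at its central element N, where the relations hold; left
    cancellation makes equality of fractions transitive. *)
Lemma braid_eq_numerator (w w' : word n) : braid_eq w w' ->
  pow (negatives w') ++ numerator w =+ pow (negatives w) ++ numerator w'.
Proof.
elim=> {w w'} [u|u v _ IH|u v w _ uv _ vw|u u' v v' _ uu _ vv|[i b]|i j ij|i j ij].
- by [].
- by symmetry.
- apply: (@peq_catI (pow (negatives v))).
  rewrite catA -pow_wordD addnC pow_wordD -catA uv.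
  rewrite catA -pow_wordD addnC pow_wordD -catA vw.
  by rewrite catA -pow_wordD addnC pow_wordD -catA.
- have shuffle a b x y : all in_range x ->
      pow (a + b) ++ (x ++ y) =+ (pow a ++ x) ++ (pow b ++ y).
    move=> Sx; rewrite pow_wordD -!catA [x ++ pow b ++ y]catA.
    by rewrite (pow_commutes b Sx) -catA.
  rewrite !negatives_cat !numerator_cat !shuffle ?numerator_in_range //.
  by rewrite uu vv.
- rewrite /numerator /num_letter /inv_letter /pow_word /negatives /=.
  by case: b; rewrite /= !cats0 ?cons_twist_quotient ?twist_quotient_cat // ord_in_range.
- by rewrite /= /numerator /= peq_far // /far ij.
- by rewrite /= /numerator /= peq_braid // /adj ij eqxx orbT.
Qed.

(** On positive words the numerator is the word itself and the denominator is 1. *)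
Lemma to_word_inj u v : all in_range u -> all in_range v ->
  braid_eq (to_word u) (to_word v) -> u =+ v.
Proof.
move=> Su Sv /braid_eq_numerator.
have H w : all in_range w -> numerator (to_word w) = w /\ negatives (to_word w) = 0.
  elim: w => //= i w IHw /andP[Si /IHw[nw ew]]; rewrite to_word_cons.
  by rewrite /numerator /= -/(numerator _) nw.
by have [-> ->] := H u Su; have [-> ->] := H v Sv.
Qed.

End Positive.

(** * Elements of standard parabolic subgroups as fractions *)

Local Open Scope group_scope.

Section Group.
Variable n : nat.
Notation in_range := (@in_range n).
Notation pow := (pow_word (twist n)).

(** Letters out of range are dropped by [to_word], so this is meaningful only for
    words whose letters are all in range. *)
Definition to_braid (u : seq nat) : braid n := braid_of (to_word n u).

Lemma braid_of_cat (u v : word n) : braid_of (u ++ v) = braid_of u * braid_of v.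
Proof. by rewrite -braid_mul_of. Qed.

Lemma braid_of_inv (w : word n) : braid_of (inv_word w) = (braid_of w)^-1.
Proof.
apply/esym/mulg1_eq; rewrite -braid_of_cat; exact/braid_ofP/cat_inv_word.
Qed.

Lemma to_braid_cat u v : to_braid (u ++ v) = to_braid u * to_braid v.
Proof. by rewrite /to_braid to_word_cat braid_of_cat. Qed.

Lemma to_braid_nil : to_braid [::] = 1. Proof. by []. Qed.

Lemma to_braid_peq u v : all in_range u -> u =+ v -> to_braid u = to_braid v.
Proof. by move=> Su uv; apply/braid_ofP/braid_eq_to_word. Qed.

Lemma to_braid_inj u v : all in_range u -> all in_range v -> to_braid u = to_braid v -> u =+ v.
Proof. by move=> Su Sv /braid_ofP; apply: to_word_inj. Qed.

Lemma braid_of_pos_letter (i : 'I_n.-1) : braid_of [:: (i, true)] = to_braid [:: val i].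
Proof. by rewrite /to_braid to_word_ord. Qed.

Lemma braid_of_neg_letter (i : 'I_n.-1) : braid_of [:: (i, false)] = (to_braid [:: val i])^-1.
Proof. by rewrite /to_braid to_word_ord -braid_of_inv. Qed.

Section Parabolic.
Variable I : {set 'I_n.-1}.

Definition in_set (i : nat) : bool := if insub i is Some o then o \in I else false.

Lemma in_set_range : subpred in_set in_range.
Proof. by move=> i; rewrite /in_set; case: insubP. Qed.

Lemma in_set_val (i : 'I_n.-1) : in_set (val i) = (i \in I).
Proof. by rewrite /in_set valK. Qed.

Definition twist_in : seq nat := full_twist in_set n.-1.

Lemma twist_in_in_set : all in_set twist_in.
Proof. by apply: sub_all (full_twist_all _ _) => i /andP[]. Qed.

Lemma twist_in_central i : in_set i -> commutes [:: i] twist_in.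
Proof. by move=> Ii; apply: full_twist_central => //; apply: in_set_range. Qed.

Lemma twist_in_ldiv i : in_set i -> ldiv [:: i] twist_in.
Proof. by move=> Ii; apply: full_twist_ldiv => //; apply: in_set_range. Qed.

Lemma in_setW u : all in_set u -> all in_range u.
Proof. by apply: sub_all => i; apply: in_set_range. Qed.

Lemma to_braid_twist_in_commute u : all in_set u ->
  to_braid u * to_braid twist_in = to_braid twist_in * to_braid u.
Proof.
move=> Iu; rewrite -!to_braid_cat; apply: to_braid_peq.
  by rewrite all_cat !in_setW // twist_in_in_set.
exact: (commutes_all twist_in_central).
Qed.

(** The inverse of a letter of I is its cofactor in the full twist of I divided by
    this full twist, which commutes with all words in I; so a single power of the
    full twist serves as the denominator u. *)
Lemma word_fraction (w : word n) : all (fun l => l.1 \in I) w ->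
  exists u v, [/\ all in_set u, all in_set v & braid_of w = (to_braid u)^-1 * to_braid v].
Proof.
move=> Iw; suff [k [v [Iv e]]] : exists k v, all in_set v /\
    braid_of w * to_braid (pow_word twist_in k) = to_braid v.
  have Ik : all in_set (pow_word twist_in k).
    by rewrite pow_word_all // twist_in_in_set.
  exists (pow_word twist_in k), v; split=> //.
  have ck : commute (to_braid (pow_word twist_in k)) (to_braid v).
    rewrite /commute -!to_braid_cat; apply: to_braid_peq.
      by rewrite all_cat !in_setW.
    by symmetry; exact: (pow_word_commutes twist_in_central).
  apply: (@mulgI _ (to_braid (pow_word twist_in k))); rewrite mulVKg.
  apply: (@mulIg _ (to_braid (pow_word twist_in k))); rewrite -!mulgA e.
  exact: ck.
elim: w Iw => [_|[i b] w IHw /= /andP[Ii /IHw [k [v [Iv e]]]]].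
  by exists 0, [::]; rewrite /pow_word /= to_braid_nil mulg1.
rewrite -in_set_val in Ii.
rewrite -cat1s braid_of_cat; case: b.
  exists k, (val i :: v); rewrite /= Ii; split=> //.
  by rewrite -mulgA e braid_of_pos_letter -to_braid_cat.
have [r ir] := twist_in_ldiv Ii.
have Ir : all in_set r by have := twist_in_in_set; rewrite -(peq_all _ ir) => /andP[].
exists k.+1, (r ++ v); rewrite all_cat Ir Iv; split=> //.
rewrite -[X in to_braid (pow_word _ X)]addn1 pow_wordD to_braid_cat -!mulgA (mulgA (braid_of w)) e.
rewrite {1}/pow_word /= cats0 to_braid_twist_in_commute // braid_of_neg_letter to_braid_cat mulgA.
congr (_ * _); rewrite -(to_braid_peq _ ir) ?to_braid_cat ?mulKg //.
by apply: in_setW; rewrite /= Ii.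
Qed.

Lemma generated_fraction x :
  generated [set sigma i | i in [set` I]]%classic x ->
  exists u v, [/\ all in_set u, all in_set v & x = (to_braid u)^-1 * to_braid v].
Proof.
pose H := [set x : braid n | exists2 w : word n, all (fun l => l.1 \in I) w &
  x = braid_of w]%classic.
have subH : is_subgroup H.
  split=> [|_ _ [u Iu ->] [v Iv ->]|_ [u Iu ->]]; first by exists [::].
    by exists (u ++ v); rewrite ?all_cat ?Iu // braid_of_cat.
  exists (inv_word u); last by rewrite braid_of_inv.
  by rewrite /inv_word all_rev all_map.
move=> /(_ H) [] // => [|w Iw ->]; last exact: word_fraction.
by split=> // _ [i /= Ii <-]; exists [:: (i, true)]; rewrite //= Ii.
Qed.

End Parabolic.

Lemma to_braid_twist_central k (x : braid n) : x * to_braid (pow k) = to_braid (pow k) * x.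
Proof.
rewrite (braid_ofE x); elim: (repr x) => [|[i b] w IHw].
  by rewrite (_ : braid_of [::] = 1) // mulg1 mul1g.
have ci : commute (to_braid [:: val i]) (to_braid (pow k)).
  rewrite /commute -!to_braid_cat; apply: to_braid_peq; last first.
    by apply: pow_commutes; rewrite /= ord_in_range.
  by rewrite /= ord_in_range pow_word_all // twist_in_range.
rewrite -cat1s braid_of_cat -mulgA IHw !mulgA; congr (_ * _); case: b.
  by rewrite braid_of_pos_letter.
by rewrite braid_of_neg_letter; apply/esym/commuteV/esym.
Qed.

(** The equation between positive words that [common_ancestor] needs holds in
    the group, after x^-1 is replaced by its cofactor z in a power of N; it
    descends to the monoid by [to_braid_inj]. *)
Lemma double_coset_middle I J (k : nat) (mg mh u v x y : seq nat) :
  all (in_set I) u -> all (in_set I) v -> all (in_set J) x -> all (in_set J) y ->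
  all in_range mg -> all in_range mh ->
  to_braid mh = (to_braid u)^-1 * to_braid v * to_braid mg * ((to_braid x)^-1 * to_braid y) ->
  ldiv mg (pow k) -> ldiv mh (pow k) ->
  exists e u' v' x' y',
   [/\ all (in_set I) u', all (in_set I) v', all (in_set J) x', all (in_set J) y' &
   [/\ e ++ x' =+ v' ++ mg, e ++ y' =+ u' ++ mh & ldiv e (pow k)]].
Proof.
move=> Iu Iv Jx Jy Smg Smh hE gk hk.
have [d [u' [v' [ud vd cuv]]]] := coprime_reduce u v.
have [d' [x' [y' [xd yd cxy]]]] := coprime_reduce x y.
have split_all P a b c : a =+ b ++ c -> all P a -> all P b /\ all P c.
  by move=> /(peq_all P)->; rewrite all_cat => /andP[].
have [_ Iu'] := split_all _ _ _ _ ud Iu; have [_ Iv'] := split_all _ _ _ _ vd Iv.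
have [_ Jx'] := split_all _ _ _ _ xd Jx; have [_ Jy'] := split_all _ _ _ _ yd Jy.
have fractionE K a b a1 b1 c : all (in_set K) a -> all (in_set K) b ->
    a =+ c ++ a1 -> b =+ c ++ b1 ->
    (to_braid a)^-1 * to_braid b = (to_braid a1)^-1 * to_braid b1.
  move=> Ka Kb ac bc; rewrite (to_braid_peq (in_setW Ka) ac) (to_braid_peq (in_setW Kb) bc).
  by rewrite !to_braid_cat invgM -mulgA mulKg.
rewrite (fractionE _ _ _ _ _ _ Iu Iv ud vd) (fractionE _ _ _ _ _ _ Jx Jy xd yd) in hE.
have Sx' := in_setW Jx'; have Sy' := in_setW Jy'.
have Su' := in_setW Iu'; have Sv' := in_setW Iv'.
have [z xz] := ldiv_pow_word (twist_in_range n) (@twist_central n) (@twist_ldiv n) Sx'.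
set j := size x' in xz.
have Sj : all in_range (pow j) by rewrite pow_word_all // twist_in_range.
have Sz : all in_range z by have := Sj; rewrite -(peq_all _ xz) all_cat => /andP[].
have zx : z ++ x' =+ pow j.
  apply: (@peq_catI x'); rewrite catA xz; symmetry; exact: pow_commutes.
have fx : (v' ++ mg ++ z) ++ x' =+ pow j ++ v' ++ mg.
  by rewrite -!catA zx catA pow_commutes // all_cat Sv'.
have fy : (v' ++ mg ++ z) ++ y' =+ pow j ++ u' ++ mh.
  apply: to_braid_inj; rewrite ?all_cat ?Sv' ?Smg ?Sz ?Sy' ?Su' ?Smh ?Sj //.
  have zE : to_braid z = (to_braid x')^-1 * to_braid (pow j).
    by rewrite -(to_braid_peq _ xz) ?to_braid_cat ?mulKg // all_cat Sx'.
  by rewrite !to_braid_cat hE zE !mulgA mulgK to_braid_twist_central !mulgA.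
have [e [ex ey ek]] := common_ancestor (@twist_central n) Su' Sv' cuv cxy fx fy gk hk.
by exists e, u', v', x', y'.
Qed.

End Group.

(** * Double cosets as components of a finite graph *)


(** Pure rewriting can be carried out inside a larger word, unlike moves at the ends. *)
Lemma conn_sub (T : eqType) (R : seq (seq T * seq T)) LW RW L p q u v L' :
  conn R [::] [::] L u v -> L + size p + size q <= L' ->
  conn R LW RW L' (p ++ u ++ q) (p ++ v ++ q).
Proof.
move=> uv LL; elim: uv => {u v} [u|u v _ IH|u v w _ uv _ vw|u v uL vL st].
- by constructor.
- by constructor.
- exact: conn_trans uv vw.
- constructor 4; rewrite ?size_cat; try lia.
  case: st => // X Y a b XY.
  have e Z : p ++ (a ++ Z ++ b) ++ q = (p ++ a) ++ Z ++ (b ++ q) by rewrite -!catA.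
  by rewrite !e; constructor.
Qed.

Section Subgroups.
Variable G : groupType.

Lemma conj_subgroup (P : set G) (c : G) :
  is_subgroup P -> is_subgroup [set x ^ c | x in P]%classic.
Proof.
move=> [P1 PM PV]; split.
- by exists 1 => //; rewrite conj1g.
- by move=> _ _ [x Px <-] [y Py <-]; exists (x * y); rewrite ?conjMg //; apply: PM.
- by move=> _ [x Px <-]; exists x^-1; rewrite ?conjVg //; apply: PV.
Qed.

Lemma generated_subgroup (S : set G) : is_subgroup (generated S).
Proof.
split=> [H [[H1 _ _] _] //|x y gx gy H sH|x gx H sH]; have [[_ HM HV] _] := sH.
  by apply: HM; [apply: gx|apply: gy].
by apply: HV; apply: gx.
Qed.

Lemma generated_sub (S : set G) x : S x -> generated S x.
Proof. by move=> Sx H [_]; apply. Qed.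

Variables A B : set G.
Hypotheses (sA : is_subgroup A) (sB : is_subgroup B).

Lemma double_coset_refl g : double_coset A g B g.
Proof.
by case: sA sB => [A1 _ _] [B1 _ _]; exists 1, 1; rewrite mul1g mulg1.
Qed.

Lemma double_coset_sym g h : double_coset A g B h -> double_coset A h B g.
Proof.
case: sA sB => [_ _ AV] [_ _ BV] [a [b [Aa Bb ->]]].
by exists a^-1, b^-1; split; [exact: AV|exact: BV|rewrite -!mulgA mulKg mulgV mulg1].
Qed.

Lemma double_coset_trans g h k :
  double_coset A g B h -> double_coset A h B k -> double_coset A g B k.
Proof.
case: sA sB => [_ AM _] [_ BM _] [a [b [Aa Bb ->]]] [a' [b' [Aa' Bb' ->]]].
by exists (a' * a), (b * b'); split; [exact: AM|exact: BM|rewrite !mulgA].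
Qed.
End Subgroups.

Section Main.
Variables (n : nat) (I J : {set 'I_n.-1}) (c d : word n).

Notation in_range := (@in_range n).
Notation N := (twist n).
Notation pow := (pow_word N).
Notation to_word := (to_word n).
Notation inv := (@inv_word n).

Definition all_letters : seq (letter n) := enum {: 'I_n.-1 * bool}.

(** The positive word for the letter l multiplied by N. *)
Definition lift_letter (l : letter n) : seq nat :=
  if l.2 then N ++ [:: val l.1] else twist_quotient n l.1.

(** All the rules hold in the braid group, so any finite list of them is sound.
    They are chosen so that a word rewrites directly to a power of N^-1 followed
    by a positive word, and so that the conjugating words can be inserted and
    removed. *)
Definition extra_rules : seq (word n * word n) :=
  [:: ([::], inv (to_word N) ++ to_word N); ([::], inv c ++ c); ([::], inv d ++ d);
      (c ++ inv c, [::]); (d ++ inv d, [::])].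

Definition rules : seq (word n * word n) :=
  braid_rules n ++
  [seq ([:: l], inv (to_word N) ++ to_word (lift_letter l)) | l <- all_letters] ++
  [seq (l :: inv (to_word N), rcons (inv (to_word N)) l) | l <- all_letters] ++
  extra_rules.

Definition left_moves : seq (word n) :=
  [seq inv c ++ [:: (i, true)] ++ c | i <- enum I].
Definition right_moves : seq (word n) :=
  [seq inv d ++ [:: (i, true)] ++ d | i <- enum J].

Lemma braid_of_inv_twist : braid_of (inv (to_word N)) = (to_braid n N)^-1.
Proof. by rewrite braid_of_inv. Qed.

Lemma to_braid_twist_commute (x : braid n) : x * to_braid n N = to_braid n N * x.
Proof. by have := to_braid_twist_central 1 x; rewrite /pow_word /= cats0. Qed.

Lemma lift_letterE l : to_braid n (lift_letter l) = to_braid n N * braid_of [:: l].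
Proof.
case: l => i [] /=; rewrite /lift_letter /=.
  by rewrite to_braid_cat braid_of_pos_letter.
rewrite braid_of_neg_letter.
have := twist_quotient_cat (ord_in_range i) => /to_braid_peq <-; last first.
  by rewrite all_cat twist_quotient_in_range ?ord_in_range //= ord_in_range.
by rewrite to_braid_cat mulgK.
Qed.

Lemma lift_letter_in_range l : all in_range (lift_letter l).
Proof.
case: l => i [] /=; rewrite /lift_letter /= ?all_cat /= ?twist_in_range /= ?ord_in_range //.
exact/twist_quotient_in_range/ord_in_range.
Qed.

Lemma lift_letter_ldiv l : ldiv (lift_letter l) (pow 2).
Proof.
case: l => i [] /=; rewrite /lift_letter /=.
  rewrite /pow_word /= cats0; apply/ldiv_cat; exact/twist_ldiv/ord_in_range.
apply: (@ldiv_pow_leq _ _ 1) => //; rewrite /pow_word /= cats0.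
by exists [:: val i]; exact/twist_quotient_cat/ord_in_range.
Qed.

Lemma mem_rules (r : word n * word n) : (r \in rules) =
  [|| r \in braid_rules n,
      r \in [seq ([:: l], inv (to_word N) ++ to_word (lift_letter l)) | l <- all_letters],
      r \in [seq (l :: inv (to_word N), rcons (inv (to_word N)) l) | l <- all_letters] |
      r \in extra_rules].
Proof. by rewrite /rules; move: (braid_rules n) => b; rewrite !mem_cat. Qed.

Lemma rules_sound X Y : (X, Y) \in rules -> braid_of X = braid_of Y.
Proof.
rewrite mem_rules => /or4P[/braid_rules_sound/braid_ofP//|/mapP[l _ [-> ->]]|/mapP[l _ [-> ->]]|].
- by rewrite braid_of_cat braid_of_inv_twist [braid_of (to_word _)]lift_letterE mulKg.
- rewrite -cat1s -cats1 !braid_of_cat braid_of_inv_twist.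
  exact/commuteV/to_braid_twist_commute.
- rewrite !inE => /orP[|/orP[|/orP[|/orP[]]]] /eqP[-> ->];
    by apply/braid_ofP; first [exact: cat_inv_word|exact: braid_eq_sym (inv_word_catl _)].
Qed.

Notation rconn := (conn rules [::] [::]).
Notation linked := (conn rules left_moves right_moves).
Notation inv_pow k := (flatten (nseq k (inv (to_word N)))).

Lemma size_inv_twist : size (inv (to_word N)) <= size N.
Proof. by rewrite size_rev size_map size_to_word. Qed.

Lemma size_inv_pow k : size (inv_pow k) <= k * size N.
Proof.
elim: k => //= k IHk; rewrite size_cat mulSn; exact: leq_add size_inv_twist IHk.
Qed.

Lemma inv_powS k : inv_pow k.+1 = inv_pow k ++ inv (to_word N).
Proof. by rewrite -addn1 nseqD flatten_cat /= cats0. Qed.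

Lemma conn_rule LW RW L X Y p q : (X, Y) \in rules ->
  size p + size X + size q <= L -> size p + size Y + size q <= L ->
  conn rules LW RW L (p ++ X ++ q) (p ++ Y ++ q).
Proof.
by move=> XY sX sY; constructor 4; rewrite ?size_cat ?addnA //; constructor.
Qed.

Lemma mem_all_letters l : l \in all_letters.
Proof. by rewrite mem_enum. Qed.

Lemma rule_lift l : ([:: l], inv (to_word N) ++ to_word (lift_letter l)) \in rules.
Proof.
rewrite mem_rules; apply/or4P; constructor 2; apply/mapP; exists l => //.
exact: mem_all_letters.
Qed.

Lemma rule_commute l : (l :: inv (to_word N), rcons (inv (to_word N)) l) \in rules.
Proof.
rewrite mem_rules; apply/or4P; constructor 3; apply/mapP; exists l => //.
exact: mem_all_letters.
Qed.

Lemma rule_extra X Y : (X, Y) \in extra_rules -> (X, Y) \in rules.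
Proof. by rewrite mem_rules => ->; rewrite !orbT. Qed.

Lemma conn_commute LW RW L p l k q :
  size p + 1 + k * size N + size q <= L ->
  conn rules LW RW L (p ++ l :: inv_pow k ++ q) (p ++ inv_pow k ++ l :: q).
Proof.
elim: k p => [|k IHk] p le; first by constructor.
have sN := size_inv_twist; have sk := size_inv_pow k.
apply: (@conn_trans _ _ _ _ _ _ (p ++ (rcons (inv (to_word N)) l) ++ inv_pow k ++ q)).
  rewrite [p ++ l :: _](_ : _ = p ++ (l :: inv (to_word N)) ++ (inv_pow k ++ q)); last first.
    by rewrite /= -catA.
  apply: conn_rule; first exact: rule_commute.
    by move: le; rewrite /= size_cat mulSn; lia.
  by move: le; rewrite size_rcons size_cat mulSn; lia.
rewrite cat_rcons catA /= -[X in conn _ _ _ _ _ (p ++ X)]catA catA.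
by apply: IHk; move: le; rewrite size_cat mulSn; lia.
Qed.

(** Long enough for a copy of N and one more letter. *)
Definition width : nat := (size N).+1.

(** Each letter is replaced by N^-1 times a positive word that divides N^2, and
    the factors N^-1 are collected in front. *)
Lemma normalize (w : word n) : exists u,
  [/\ all in_range u, ldiv u (pow (2 * size w)),
   to_braid n u = to_braid n (pow (size w)) * braid_of w &
   rconn ((3 * size w + 1) * width) w (inv_pow (size w) ++ to_word u)].
Proof.
elim: w => [|l w [u [Su ku uE uw]]].
  by exists [::]; split; [|exact: ldiv_refl|rewrite to_braid_nil mul1g|constructor].
exists (lift_letter l ++ u); have Sl := lift_letter_in_range l.
have kl := lift_letter_ldiv l.
split.
- by rewrite all_cat Sl.
- by rewrite /= mulnS; apply: (ldiv_powM (twist_in_range n) (@twist_central n) Su kl ku).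
- rewrite to_braid_cat uE lift_letterE -!mulgA (mulgA (braid_of [:: l])) to_braid_twist_central.
  rewrite -(cat1s l w) braid_of_cat /pow_word /= to_braid_cat.
  by rewrite !mulgA.
- have sN := size_inv_twist; have sk := size_inv_pow (size w).
  have su : size u <= 2 * size w * size N by rewrite -size_pow_word; apply: ldiv_size.
  have sl : size (lift_letter l) <= 2 * size N by rewrite -size_pow_word; apply: ldiv_size.
  have spu := size_to_word n u; have spl := size_to_word n (lift_letter l).
  apply: (@conn_trans _ _ _ _ _ _ (l :: inv_pow (size w) ++ to_word u)).
    have := @conn_sub _ _ [::] [::] _ [:: l] [::] _ _
      ((3 * size (l :: w) + 1) * width) uw.
    rewrite !cats0; apply; rewrite /= addn0 /width mulnS !mulnDl; lia.
  apply: (@conn_trans _ _ _ _ _ _ (inv_pow (size w) ++ l :: to_word u)).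
    apply: (@conn_commute [::] [::] _ [::]).
    by rewrite /= /width; nia.
  rewrite -[size (l :: w)]/(size w).+1 inv_powS to_word_cat -catA.
  rewrite -[l :: to_word u]/([:: l] ++ to_word u) (catA (inv (to_word N))).
  by apply: conn_rule; first exact: rule_lift; rewrite /width ?size_cat /=; nia.
Qed.

Lemma rconn_leq L L' u v : rconn L u v -> L <= L' -> rconn L' u v.
Proof.
move=> uv LL; have := @conn_sub _ _ [::] [::] _ [::] [::] _ _ L' uv.
by rewrite /= !cats0; apply; rewrite /= !addn0.
Qed.

(** The exponent can be increased by inserting N^-1 N, which gives two words a
    common denominator. *)
Lemma normalize_leq (w : word n) k : size w <= k -> exists u,
  [/\ all in_range u, ldiv u (pow (2 * k)),
   to_braid n u = to_braid n (pow k) * braid_of w &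
   rconn ((3 * k + 1) * width) w (inv_pow k ++ to_word u)].
Proof.
elim: k => [|k IHk]; first by rewrite leqn0 => /eqP e; have := normalize w; rewrite e.
rewrite leq_eqVlt => /orP[/eqP e|]; first by have := normalize w; rewrite e.
rewrite ltnS => /IHk [u [Su ku uE uw]]; exists (N ++ u).
have N1 : ldiv N (pow 2) by rewrite /pow_word /= cats0; apply: ldiv_catr.
split.
- by rewrite all_cat twist_in_range.
- by rewrite mulnS; apply: (ldiv_powM (twist_in_range n) (@twist_central n) Su N1 ku).
- by rewrite to_braid_cat uE /pow_word /= to_braid_cat mulgA.
- have sN := size_inv_twist; have sk := size_inv_pow k.
  have su : size u <= 2 * k * size N by rewrite -size_pow_word; apply: ldiv_size.
  have spu := size_to_word n u; have spN := size_to_word n N.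
  apply: (@conn_trans _ _ _ _ _ _ (inv_pow k ++ [::] ++ to_word u)).
    by apply: rconn_leq uw _; rewrite leq_mul // leq_add2r leq_mul.
  rewrite inv_powS to_word_cat -catA (catA (inv (to_word N))).
  apply: conn_rule; first by apply: rule_extra; rewrite inE eqxx.
    by rewrite /width /=; nia.
  by rewrite /width ?size_cat /=; nia.
Qed.

(** The positive word m represents c^-1 N^-k m d: a left move by a conjugate
    c^-1 s c and a right move by d^-1 t d become the multiplications of m by s
    on the left and by t on the right. *)
Definition wrap (k : nat) (m : seq nat) : word n :=
  inv c ++ inv_pow k ++ to_word m ++ d.

Lemma size_inv (w : word n) : size (inv w) = size w.
Proof. by rewrite size_rev size_map. Qed.

(** The room needed to perform moves on a wrapped word of length s. *)
Definition wrap_bound (k s : nat) : nat :=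
  3 * (size c + size d) + k * size N + s + 1.

Lemma braid_rules_size X Y : (X, Y) \in braid_rules n -> size X = size Y.
Proof. by rewrite mem_cat => /orP[] /allpairsPdep[i [j [_ _ [-> ->]]]]. Qed.

Lemma conn_wrap_peq k u v L : all in_range u -> u =+ v ->
  wrap_bound k (size u) <= L -> linked L (wrap k u) (wrap k v).
Proof.
move=> Su uv; have := size_to_word n u; have sk := size_inv_pow k.
pose E (w w' : word n) := size w = size w' /\ (forall p q,
  size p + size w + size q <= L -> linked L (p ++ w ++ q) (p ++ w' ++ q)).
have [_ H] : E (to_word u) (to_word v).
  apply: to_word_peq Su uv => [w|w1 w2 w3 [e1 E1] [e2 E2]|X Y p XY q].
  - by split=> // p q _; constructor.
  - split=> [|p q le]; first by rewrite e1.
    by apply: conn_trans (E1 _ _ le) (E2 _ _ _); rewrite -e1.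
  - have e := braid_rules_size XY; split=> [|p' q' le].
      by rewrite !size_cat e.
    have assoc Z : p' ++ (p ++ Z ++ q) ++ q' = (p' ++ p) ++ Z ++ (q ++ q').
      by rewrite -!catA.
    have XYr : (X, Y) \in rules by rewrite mem_rules XY.
    rewrite !assoc; apply: conn_rule => //; move: le; rewrite !size_cat -?e; lia.
move=> su le; have := H (inv c ++ inv_pow k) d; rewrite /wrap -!catA; apply.
by move: le; rewrite /wrap_bound size_cat size_inv; lia.
Qed.

Lemma size_word_cat (w w' : word n) : size (w ++ w') = (size w + size w')%N.
Proof. exact: size_cat. Qed.

Lemma conn_wrap_left k s u L : in_set I s -> all in_range u ->
  wrap_bound k (size u).+1 <= L -> linked L (wrap k u) (wrap k (s :: u)).
Proof.
rewrite /in_set; case: insubP => // l _ <- lI Su le.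
have su := size_to_word n u; have sk := size_inv_pow k; rewrite /wrap_bound in le.
apply: (@conn_trans _ _ _ _ _ _ ((inv c ++ [:: (l, true)] ++ c) ++ wrap k u)).
  constructor 4.
  - by rewrite /wrap !size_word_cat size_inv; lia.
  - by rewrite /wrap !size_word_cat size_inv /=; lia.
  - by constructor; apply/mapP; exists l; rewrite ?mem_enum.
apply: (@conn_trans _ _ _ _ _ _
    ((inv c ++ [:: (l, true)]) ++ [::] ++ (inv_pow k ++ to_word u ++ d))).
  have -> : (inv c ++ [:: (l, true)] ++ c) ++ wrap k u =
      (inv c ++ [:: (l, true)]) ++ (c ++ inv c) ++ (inv_pow k ++ to_word u ++ d).
    by rewrite /wrap -!catA.
  apply: conn_rule; first by apply: rule_extra; rewrite !inE eqxx !orbT.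
    by rewrite !size_word_cat size_inv /=; lia.
  by rewrite !size_word_cat size_inv /=; lia.
rewrite -catA /wrap to_word_ord /=; apply: conn_commute.
by rewrite !size_word_cat size_inv; lia.
Qed.

Lemma conn_wrap_right k s u L : in_set J s -> all in_range u ->
  wrap_bound k (size u).+1 <= L -> linked L (wrap k u) (wrap k (rcons u s)).
Proof.
rewrite /in_set; case: insubP => // l _ <- lJ Su le.
have su := size_to_word n u; have sk := size_inv_pow k; rewrite /wrap_bound in le.
apply: (@conn_trans _ _ _ _ _ _ (wrap k u ++ (inv d ++ [:: (l, true)] ++ d))).
  constructor 4.
  - by rewrite /wrap !size_word_cat size_inv; lia.
  - by rewrite /wrap !size_word_cat !size_inv /=; lia.
  - by constructor; apply/mapP; exists l; rewrite ?mem_enum.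
rewrite /wrap -cats1 to_word_cat to_word_ord.
have -> : (inv c ++ inv_pow k ++ to_word u ++ d) ++ (inv d ++ [:: (l, true)] ++ d) =
    (inv c ++ inv_pow k ++ to_word u) ++ (d ++ inv d) ++ ([:: (l, true)] ++ d).
  by rewrite -!catA.
have -> : inv c ++ inv_pow k ++ (to_word u ++ [:: (l, true)]) ++ d =
    (inv c ++ inv_pow k ++ to_word u) ++ [::] ++ ([:: (l, true)] ++ d).
  by rewrite -!catA.
apply: conn_rule; first by apply: rule_extra; rewrite !inE eqxx !orbT.
  by rewrite !size_word_cat !size_inv /=; lia.
by rewrite !size_word_cat !size_inv /=; lia.
Qed.

Lemma conn_wrap g k u L :
  rconn ((3 * k + 1) * width) (c ++ g ++ inv d) (inv_pow k ++ to_word u) ->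
  (3 * k + 1) * width + 2 * (size c + size d) + size g <= L ->
  linked L g (wrap k u).
Proof.
move=> gu le.
apply: (@conn_trans _ _ _ _ _ _ (inv c ++ (c ++ g))).
  rewrite catA -[X in linked _ X]/([::] ++ [::] ++ g) -[X in linked _ _ X]/([::] ++ _ ++ g).
  apply: conn_rule; first by apply: rule_extra; rewrite !inE eqxx !orbT.
    by rewrite /=; lia.
  by rewrite !size_word_cat !size_inv /=; lia.
apply: (@conn_trans _ _ _ _ _ _ (inv c ++ (c ++ g ++ inv d) ++ d)).
  have -> : inv c ++ c ++ g = (inv c ++ c ++ g) ++ [::] ++ [::] by rewrite !cats0.
  have -> : inv c ++ (c ++ g ++ inv d) ++ d = (inv c ++ c ++ g) ++ (inv d ++ d) ++ [::].
    by rewrite !cats0 -!catA.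
  apply: conn_rule; first by apply: rule_extra; rewrite !inE eqxx !orbT.
    by rewrite !size_word_cat !size_inv /=; lia.
  by rewrite !size_word_cat !size_inv /=; lia.
rewrite /wrap (catA (inv_pow k)); apply: conn_sub gu _.
apply: leq_trans le; rewrite size_inv -[leqLHS]addnA -[leqRHS]addnA leq_add2l.
by rewrite mul2n -addnn -addnA leq_addr.
Qed.

(** A coefficient for which the estimates of [slope_bound] hold; n and the
    conjugating words are constant. *)
Definition slope : nat :=
  3 * (size c + size d) + 2 + (12 * (size c + size d) + 8) * width.

Lemma wrap_bound_leq k s t : s <= t -> wrap_bound k s <= wrap_bound k t.
Proof. by move=> st; rewrite /wrap_bound leq_add2r leq_add2l. Qed.

Lemma slope_bound s t k : k = (2 * (size c + size d) + (s + t))%N ->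
  wrap_bound k ((2 * k).+1 * size N) <= slope * (s + t + 1) /\
  (3 * k + 1) * width + 2 * (size c + size d) + (s + t) <= slope * (s + t + 1).
Proof.
move=> kE; set e := size c + size d in kE *.
have kle : k <= (2 * e + 1) * (s + t + 1) by rewrite kE; nia.
have kw : k * width <= (2 * e + 1) * (s + t + 1) * width by rewrite leq_mul.
have Nw : (2 * k + 1 + k) * size N <= (3 * k + 1) * width.
  by apply: leq_mul => //; rewrite mulSn addnC addnA.
rewrite /wrap_bound /slope -/e; split; nia.
Qed.

(** The words c g d^-1 and c h d^-1 are brought to the same denominator N^k; their
    numerators divide N^(2k), hence are joined through the middle element e. *)
Lemma double_coset_conn (p q : braid n) (g h : word n) :
  generated [set sigma i | i in [set` I]]%classic p ->
  generated [set sigma i | i in [set` J]]%classic q ->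
  braid_of h = p ^ braid_of c * braid_of g * q ^ braid_of d ->
  linked (slope * (size g + size h + 1)) g h.
Proof.
move=> /generated_fraction[u [v [Iu Iv ->]]] /generated_fraction[x [y [Jx Jy ->]]] hE.
pose wr (w : word n) := c ++ w ++ inv d.
have size_wr w : size (wr w) = (size c + size w + size d)%N.
  by rewrite !size_word_cat size_inv addnA.
pose k := (size (wr g) + size (wr h))%N.
have [mg [Sg gk gE gu]] := normalize_leq (leq_addr (size (wr h)) (size (wr g))).
have [mh [Sh hk hE' hu]] := normalize_leq (leq_addl (size (wr g)) (size (wr h))).
rewrite -/k in gk gE gu hk hE' hu.
have mhE : to_braid n mh =
    (to_braid n u)^-1 * to_braid n v * to_braid n mg * ((to_braid n x)^-1 * to_braid n y).
  rewrite hE' gE; set P := (X in X * _ * _).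
  rewrite (mulgA P) to_braid_twist_central /wr !braid_of_cat braid_of_inv hE !conjgE.
  by rewrite !mulgA !mulgK.
have [e [u' [v' [x' [y' [Iu' Iv' Jx' Jy' [ex ey ek]]]]]]] :=
  double_coset_middle Iu Iv Jx Jy Sg Sh mhE gk hk.
set L := (slope * _)%N.
have [Lpath Lwrap] : wrap_bound k ((2 * k).+1 * size N) <= L /\
    (3 * k + 1) * width + 2 * (size c + size d) + (size g + size h) <= L.
  apply: slope_bound; rewrite /k !size_wr.
  by clear; move: (size c) (size d) (size g) (size h) => *; lia.
pose E m m' := linked L (wrap k m) (wrap k m').
have path a m b : all (in_set I) a -> all (in_set J) b -> all in_range m ->
    e ++ b =+ a ++ m -> ldiv m (pow (2 * k)) -> E e m.
  move=> Ia Jb Sm eb mk.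
  have Se : all in_range e.
    have : all in_range (e ++ b) by rewrite (peq_all _ eb) all_cat Sm (in_setW Ia).
    by rewrite all_cat => /andP[].
  apply: (convex_path (twist_in_range n) (@twist_central n) (@twist_ldiv n)
    (@in_set_range n I) (@in_set_range n J) (r := 2 * k) (E := E)
    _ _ _ _ _ Ia Sm Se Jb _ ek mk).
  - by move=> m1 m2; apply: conn_sym.
  - by move=> m1 m2 m3; apply: conn_trans.
  - move=> m1 m2 Sm1 sm1 m12; apply: conn_wrap_peq => //.
    exact: leq_trans (wrap_bound_leq _ sm1) Lpath.
  - move=> s m1 Is Sm1 sm1; apply: conn_wrap_left => //.
    exact: leq_trans (wrap_bound_leq _ sm1) Lpath.
  - move=> s m1 Js Sm1; rewrite size_rcons => sm1; apply: conn_wrap_right => //.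
    exact: leq_trans (wrap_bound_leq _ sm1) Lpath.
  - by symmetry.
apply: (@conn_trans _ _ _ _ _ _ (wrap k mg)).
  by apply: conn_wrap gu _; apply: leq_trans Lwrap; rewrite leq_add2l leq_addr.
apply: (@conn_trans _ _ _ _ _ _ (wrap k mh)); last first.
  by apply/conn_sym/(conn_wrap hu); apply: leq_trans Lwrap; rewrite leq_add2l leq_addl.
apply: (@conn_trans _ _ _ _ _ _ (wrap k e)).
  by apply: conn_sym; apply: (path v' mg x').
by apply: (path u' mh y').
Qed.

Lemma step_double_coset (A B : set (braid n)) (u v : word n) :
  is_subgroup A -> is_subgroup B ->
  (forall i, i \in I -> A (sigma i ^ braid_of c)) ->
  (forall i, i \in J -> B (sigma i ^ braid_of d)) ->
  step rules left_moves right_moves u v ->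
  double_coset A (braid_of u) B (braid_of v).
Proof.
move=> sA sB AI BJ; have [A1 _ _] := sA; have [B1 _ _] := sB.
case=> [X Y p q /rules_sound XY|z w /mapP[i iI ->]|z w /mapP[i iJ ->]].
- by rewrite !braid_of_cat XY; apply: double_coset_refl.
- exists (sigma i ^ braid_of c), 1; rewrite mulg1; split=> //.
    by apply: AI; rewrite -mem_enum.
  by rewrite !braid_of_cat braid_of_inv conjgE.
- exists 1, (sigma i ^ braid_of d); rewrite mul1g; split=> //.
    by apply: BJ; rewrite -mem_enum.
  by rewrite !braid_of_cat braid_of_inv conjgE.
Qed.

End Main.

Lemma code_letter_inj n : injective (@code_letter n).
Proof.
move=> [i b] [j b'] /= e; have eb : ~~ b = ~~ b'.
  by move/(congr1 odd): e; rewrite /code_letter /= !oddD !odd_double !oddb.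
move: e; rewrite /code_letter /= eb => /addIn /double_inj /val_inj ->.
by move/negb_inj: eb => ->.
Qed.

Lemma code_letter_bound n (l : letter n) : code_letter l < n.*2.
Proof.
case: l => i b; rewrite /code_letter /=; have := ltn_ord i.
by case: b => /=; rewrite -!muln2; lia.
Qed.

Theorem theorem1p4 (n : nat) (A B : set (braid n)) :
  (1 <= n)%N -> parabolic A -> parabolic B -> double_coset_problem_solvable A B.
Proof.
move=> _ [_ [c [[I ->] AE]]] [_ [d [[J ->] BE]]].
have sA : is_subgroup A by rewrite AE; apply/conj_subgroup/generated_subgroup.
have sB : is_subgroup B by rewrite BE; apply/conj_subgroup/generated_subgroup.
pose cw : word n := repr c; pose dw : word n := repr d.
pose rel (g h : word n) := double_coset A (braid_of g) B (braid_of h).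
have sound g h : step (rules cw dw) (left_moves I cw) (right_moves J dw) g h -> rel g h.
  apply: step_double_coset => // i iI.
    rewrite AE /cw -braid_ofE; exists (sigma i) => //.
    by apply: generated_sub; exists i.
  rewrite BE /dw -braid_ofE; exists (sigma i) => //.
  by apply: generated_sub; exists i.
have complete g h : rel g h ->
    conn (rules cw dw) (left_moves I cw) (right_moves J dw)
      (slope cw dw * (size g + size h + 1)) g h.
  move=> [a [b [+ + hE]]]; rewrite AE BE => -[a' a'P aE] [b' b'P bE].
  apply: double_coset_conn a'P b'P _.
  by rewrite /cw /dw -!braid_ofE aE bE.
have [p hp] := decide_connected (@code_letter_inj n) (@code_letter_bound n)
  (fun g => double_coset_refl sA sB (braid_of g))
  (fun g h => double_coset_sym sA sB (g := braid_of g) (h := braid_of h))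
  (fun g h k => double_coset_trans sA sB (g := braid_of g) (h := braid_of h)
     (k := braid_of k)) sound complete.
by exists p => g h; apply: hp.
Qed.
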